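(* Let $n\ge 1$ and $r\in\{1,\dots,n\}$. Then $$\mathrm{Ch}\,\big(\chi^r\uparrow_{C_n}^{S_n}\big)=\mathrm{NFD}_{n,r}^{\mathrm{cont}}(\mathbf{x})=\mathrm{F}_{n,r}^{\mathrm{cont}}(\mathbf{x})=\mathrm{M}_{n,r}^{\mathrm{cont}}(\mathbf{x}).$$
   Context: Representations are over $\mathbb{C}$; $\uparrow$ denotes induction. $C_n=\langle\sigma_n\rangle\le S_n$ with $\sigma_n=(1\,2\,\cdots\,n)$; $\omega_n$ is a fixed primitive $n$th root of unity and $\chi^r$ is the one-dimensional representation of $C_n$ with $\chi^r(\sigma_n)=\omega_n^r$. $\mathrm{Ch}$ is the Frobenius characteristic: $\mathrm{Ch}\,S^\lambda=s_\lambda(\mathbf{x})$ for the Specht module $S^\lambda$, extended additively, with $\mathbf{x}=(x_1,x_2,\dots)$. $W_n$ is the set of words $w=w_1\cdots w_n$ with letters $w_i\in\mathbb{Z}_{\ge1}$. $\mathrm{cont}(w)=(\alpha_1,\alpha_2,\dots)$ where $\alpha_j$ is the number of $j$'s in $w$, and $\mathbf{x}^{\alpha}=\prod_j x_j^{\alpha_j}$. A necklace is an orbit $[w]$ of $W_n$ under cyclic rotation; $N_n$ denotes the set of all necklaces of length $n$ words. Each $w\in W_n$ is uniquely $w=v^f$ with $v$ primitive (not a proper power); $\mathrm{freq}(w)=f$. Content and frequency are well defined on necklaces. $\mathrm{lex}(w)$ is the position (starting from $1$) of $w$ in the lexicographic order of its distinct cyclic rotations, and $\mathrm{flex}(w)=\mathrm{freq}(w)\cdot\mathrm{lex}(w)$.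 $\mathrm{maj}(w)=\sum_{1\le i<n,\ w_i>w_{i+1}} i$, and $\mathrm{maj}_n(w)\in\{1,\dots,n\}$ is the residue of $\mathrm{maj}(w)$ modulo $n$. $\mathrm{NFD}_{n,r}=\{N\in N_n:\mathrm{freq}(N)\mid r\}$, $\mathrm{F}_{n,r}=\{w\in W_n:\mathrm{flex}(w)=r\}$, $\mathrm{M}_{n,r}=\{w\in W_n:\mathrm{maj}_n(w)=r\}$. For a set $A$ of words or necklaces, $A^{\mathrm{cont}}(\mathbf{x})=\sum_{a\in A}\mathbf{x}^{\mathrm{cont}(a)}$. *)

(* Defs.v *)
From HB Require Import structures.
From mathcomp Require Export all_boot all_order all_fingroup all_algebra.
From mathcomp Require Export cyclic algC mxrepresentation classfun character.
From mathcomp Require Export finmap multiset.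
From mathcomp Require Export boolp classical_sets functions cardinality fsbigop.

Set Implicit Arguments.
Unset Strict Implicit.
Unset Printing Implicit Defensive.

Import Order.TTheory GRing.Theory Num.Theory.

Local Open Scope ring_scope.

(* Formal power series in x_1, x_2, ... over algC are coefficient functions on
   monomials; the monomial \prod_j x_j ^ alpha_j is the multiset of natural
   numbers in which j has multiplicity alpha_j.  Letters and tableau entries
   are required to be positive below, so no series considered involves an x_0. *)
Definition monomial := {mset nat}%mset.
Definition fseries := monomial -> algC.

(* The series \sum_(a in A) x^(cont a).  The sum giving a coefficient is the
   finite-support sum of fsbigop, which is 0 by convention on infinite support;
   it is used for sets A having finitely many elements of each content. *)
Definition content_gf (T : choiceType) (cont : T -> monomial) (A : set T) :
    fseries :=
  fun alpha => \sum_(a \in A) ((cont a == alpha)%:R : algC).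

Section Words.
Local Open Scope classical_set_scope.
Local Open Scope nat_scope.

Definition words (n : nat) : set (seq nat) :=
  [set w | size w = n /\ all (leq 1) w].

Definition wcont (w : seq nat) : monomial := seq_mset w.

Definition wpow (v : seq nat) (f : nat) : seq nat := flatten (nseq f v).

Definition primitive_word (v : seq nat) : Prop :=
  ~ exists u : seq nat, exists2 k, 1 < k & v = wpow u k.

Definition freq (w : seq nat) : nat :=
  xget 0 [set f | exists2 v, primitive_word v & w = wpow v f].

Definition lex (w : seq nat) : nat :=
  (index w (sort (fun u v : seqlexi nat => (u <= v)%O)
                 (undup [seq rot i w | i <- iota 0 (size w)]))).+1.

Definition flex (w : seq nat) : nat := freq w * lex w.

(* The letter w_i is nth 0 w i.-1. *)
Definition maj (w : seq nat) : nat :=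
  \sum_(1 <= i < size w | nth 0 w i < nth 0 w i.-1) i.

Definition majn (n : nat) (w : seq nat) : nat :=
  if maj w %% n == 0 then n else maj w %% n.

Definition necklace (w : seq nat) : set (seq nat) := range (fun i => rot i w).

Definition necklaces (n : nat) : set (set (seq nat)) := necklace @` words n.

(* Functions of words that are invariant under rotation are evaluated on a
   necklace through an arbitrary representative. *)
Definition ncont (N : set (seq nat)) : monomial := wcont (xget [::] N).
Definition nfreq (N : set (seq nat)) : nat := freq (xget [::] N).

Definition NFD (n r : nat) : set (set (seq nat)) :=
  [set N | necklaces n N /\ nfreq N %| r].

Definition Flex (n r : nat) : set (seq nat) :=
  [set w | words n w /\ flex w = r].

Definition Maj (n r : nat) : set (seq nat) :=
  [set w | words n w /\ majn n w = r].

End Words.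

Section Partitions.
Local Open Scope classical_set_scope.
Local Open Scope nat_scope.

(* A partition of n, padded with zeros to length n. *)
Definition parts (n : nat) (la : n.-tuple 'I_n.+1) : seq nat := map val la.

Definition is_part (n : nat) (la : n.-tuple 'I_n.+1) : bool :=
  sorted geq (parts la) && (sumn (parts la) == n).

(* A tableau is the list of its rows. *)
Definition ssyt (la : seq nat) : set (seq (seq nat)) :=
  [set T | [/\ shape T = la, all (all (leq 1)) T, all (sorted leq) T &
     forall i j, j < nth 0 la i.+1 ->
       nth 0 (nth [::] T i) j < nth 0 (nth [::] T i.+1) j]].

Definition tcont (T : seq (seq nat)) : monomial := seq_mset (flatten T).

End Partitions.

Definition schur (la : seq nat) : fseries := content_gf tcont (ssyt la).

(* In the tableau t of shape la filled with 0, 1, ..., n - 1 row by row, the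
   entry k is in row reshape_index la k and column reshape_offset la k. *)
Definition row_stab (n : nat) (la : seq nat) : {set 'S_n} :=
  [set p : 'S_n | [forall k, reshape_index la (p k) == reshape_index la k]].

Definition col_stab (n : nat) (la : seq nat) : {set 'S_n} :=
  [set q : 'S_n | [forall k, reshape_offset la (q k) == reshape_offset la k]].

(* The Specht module is the span of the polytabloids inside the module M^la of
   tabloids, which is realised in the group algebra (the right regular
   representation) by mapping the tabloid {t g} to the sum of the elements of
   the coset (row_stab la) g.  The polytabloid
   e_t = \sum_q sgn(q) {t q}, q ranging over the column stabiliser, then becomes
   the Young symmetrizer below.  Since e_(t g) = e_t g, the span of all
   polytabloids is the cyclic module generated by e_t. *)
Definition polytabloid (n : nat) (la : seq nat) :
    'rV[algC]_#|[set: 'S_n]%G| :=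
  \sum_(q in col_stab n la) \sum_(p in row_stab n la)
     (-1) ^+ q *: delta_mx 0 (gring_index [set: 'S_n]%G (p * q)%g).

Definition specht (n : nat) (la : seq nat) :=
  submod_repr (cyclic_mx_module (regular_repr algC [set: 'S_n]%G)
                                (polytabloid n la)).

(* The Frobenius characteristic of a representation with character phi:
   \sum_la m_la s_la, where m_la is the multiplicity of S^la. *)
Definition Ch (n : nat) (phi : 'CF([set: 'S_n])) : fseries :=
  fun alpha => \sum_(la : n.-tuple 'I_n.+1 | is_part la)
     '[phi, cfRepr (specht n (parts la))] * schur (parts la) alpha.

Definition sigma (n : nat) : 'S_n := perm (@ordS_inj n).

Definition Cn (n : nat) : {group 'S_n} := <[sigma n]>%G.

Lemma sigmaXE n k (i : 'I_n) : (sigma n ^+ k)%g i = ((i + k) %% n)%N :> nat.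
Proof.
elim: k => [|k IH]; first by rewrite expg0 perm1 addn0 modn_small.
by rewrite expgSr permM permE /= IH addnS -addn1 modnDml addn1.
Qed.

(* The least k with sigma ^ k = g. *)
Definition sigma_log (n : nat) (g : 'S_n) : nat :=
  index g [seq (sigma n ^+ k)%g | k <- iota 0 n].

Definition chi_mx (n : nat) (omega : algC) (r : nat) (g : 'S_n) : 'M[algC]_1 :=
  ((omega ^+ r) ^+ sigma_log g)%:M.

Lemma chi_mx_sigmaX n omega r k : n.-primitive_root omega ->
  chi_mx omega r (sigma n ^+ k)%g = ((omega ^+ r) ^+ k)%:M.
Proof.
move=> prim; have n_gt0 := prim_order_gt0 prim.
have sX m : (sigma n ^+ m)%g = (sigma n ^+ (m %% n)%N)%g.
  by apply/permP => i; apply: val_inj; rewrite /= !sigmaXE modnDmr.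
have s_in : (sigma n ^+ k)%g \in [seq (sigma n ^+ j)%g | j <- iota 0 n].
  by rewrite sX; apply: map_f; rewrite mem_iota /= add0n ltn_pmod.
congr (_%:M); rewrite /sigma_log.
have lt_ix := s_in; rewrite -index_mem size_map size_iota in lt_ix.
have := nth_index 1%g s_in.
rewrite (nth_map 0%N) ?size_iota // nth_iota // add0n.
move/permP/(_ (Ordinal n_gt0))/(congr1 val).
rewrite /= !sigmaXE /= !add0n => eq_mod.
rewrite -!exprM; apply/eqP; rewrite (eq_prim_root_expr prim).
by rewrite -modnMmr eq_mod modnMmr.
Qed.

Lemma chi_mx_repr n omega r (prim : n.-primitive_root omega) :
  mx_repr (Cn n) (@chi_mx n omega r).
Proof.
split=> [|x y /cycleP[i ->] /cycleP[j ->]].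
  by rewrite -(expg0 (sigma n)) chi_mx_sigmaX.
by rewrite -expgD !chi_mx_sigmaX // exprD scalar_mxM.
Qed.

Definition chi n omega (prim : n.-primitive_root omega) r :
    mx_representation algC (Cn n) 1 :=
  MxRepresentation (chi_mx_repr r prim).

Lemma chi_sigma n omega (prim : n.-primitive_root omega) r :
  chi prim r (sigma n) = (omega ^+ r)%:M.
Proof. by have := chi_mx_sigmaX r 1 prim; rewrite expg1 expr1. Qed.

(* Main.v *)
(* The coefficient of x^(cont s) in each of the four series is
   (1/n) \sum_(k < n) omega^(r k) Fix_k, where Fix_k is the number of
   rearrangements of s fixed by the rotation by k places.

   Necklaces: a necklace of frequency f has n/f words, fixed by the rotations by
   multiples of n/f, so it contributes 1 to the sum if f divides r and 0
   otherwise; on its words flex takes the values f, 2f, ..., n.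

   Major index: by MacMahon's formula (by induction, through the refinement by
   the last letter) \sum_w q^(maj w) is the q-multinomial coefficient, whose
   value at omega^k is Fix_k; then extract the residue class of maj modulo n.

   Frobenius characteristic: by Young's rule the coefficient of Ch phi is the
   scalar product of phi with the permutation character pi_s of S_n on the
   rearrangements of s, and Frobenius reciprocity applies to phi = Ind chi^r.
   For Young's rule, <S^la, rho> is the rank of the Young symmetrizer in rho.  This
   gives the orthogonality of the Specht characters, by sorting columns, and
   <S^la, pi_s> >= K_(la,s), by a triangularity argument.  Equality follows by
   comparing degrees, as RSK insertion gives |perms s| <= \sum_la K_(la,s) f^la. *)

From HB Require Import structures.
Require Import Defs.
From mathcomp Require Import zify.
Import Order.TTheory GRing.Theory Num.Theory.

Set Implicit Arguments.
Unset Strict Implicit.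
Unset Printing Implicit Defensive.

Local Open Scope ring_scope.

(** * Characters of cyclic submodules of the regular representation *)

(** Young's rule is squeezed out of one-sided estimates, which fixes the form of the lemmas: scalar
    products of Specht characters are bounded above by a Kronecker delta, multiplicities and degrees
    are bounded below by numbers of fillings, and RSK enters as an injection. Both kinds of bound
    concern a rank: above, by a small space containing the image; below, by a triangular submatrix.
    The number f^la of standard fillings is K_(la,s) for s with the letters 0, ..., n - 1, whose
    permutation module is the regular one; so the bound for multiplicities also bounds degrees. On
    the major index side the obstacle is that MacMahon's quotient can be 0/0 at a root of unity:
    factors [d] must be cancelled as polynomials before evaluating at a primitive d-th root.
    Moreover, extracting the class of r from the powers omega^(k maj) produces the complex conjugate
    of the sum attached to flex; the two agree because the latter is n times a number of words,
    hence real. *)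

Lemma mxtrace_idempotent (F : fieldType) (n : nat) (A : 'M[F]_n) :
  A *m A = A -> \tr A = (\rank A)%:R.
Proof.
move=> idA.
have [C' C'C] : exists C', C' *m col_base A = 1%:M.
  exact/row_fullP/col_base_full.
have [R' RR'] : exists R', row_base A *m R' = 1%:M.
  exact/row_freeP/row_base_free.
move: (col_base A) (row_base A) (mulmx_base A) C'C RR' => C R eqA C'C RR'.
(* In a full-rank factorization A = C R, idempotence forces R C = 1, and the trace of C R is that of
   R C. *)
rewrite -[in LHS]eqA mxtrace_mulC; suff -> : R *m C = 1%:M by rewrite mxtrace1.
have : C' *m (C *m R *m (C *m R)) *m R' = C' *m (C *m R) *m R' by rewrite eqA idA.
by rewrite !mulmxA C'C !mul1mx -!mulmxA RR' mulmx1.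
Qed.

Section RankCyclic.
Variables (gT : finGroupType) (G : {group gT}).
Local Notation aG := (regular_repr algC G).
Local Notation idx := (gring_index G).

Lemma gring_mx_delta n (rho : mx_representation algC G n) x :
  x \in G -> gring_mx rho (delta_mx 0 (idx x)) = rho x.
Proof.
by move=> Gx; rewrite /gring_mx /= -rowE rowK mxvecK gring_indexK.
Qed.

Lemma row_gring_sum (u : 'rV[algC]_#|G|) :
  u = \sum_(x in G) u 0 (idx x) *: delta_mx 0 (idx x).
Proof.
rewrite {1}(row_sum_delta u) (reindex_onto idx (@enum_val gT G)) => [|i _];
  last first.
  by rewrite gring_valK.
apply: eq_big => [x|//].
apply/eqP/idP => [<-|Gx]; first exact: enum_valP.
by rewrite gring_indexK.
Qed.

Lemma gring_mx_sum n (rho : mx_representation algC G n) (u : 'rV[algC]_#|G|) :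
  gring_mx rho u = \sum_(x in G) u 0 (idx x) *: rho x.
Proof.
rewrite [u in LHS]row_gring_sum linear_sum; apply: eq_bigr => x Gx.
by rewrite linearZ /= gring_mx_delta.
Qed.

Lemma mul_row_regular (u : 'rV[algC]_#|G|) x y : x \in G -> y \in G ->
  (u *m aG x) 0 (idx y) = u 0 (idx (y * x^-1)%g).
Proof.
move=> Gx Gy; rewrite [u in LHS]row_gring_sum mulmx_suml summxE.
rewrite (bigD1 (y * x^-1)%g) ?groupM ?groupV //= big1 => [|z /andP[Gz zNyx]];
  rewrite -scalemxAl mxE -rowE rowK gring_indexK ?groupM ?groupV // mxE eqxx /=.
  by rewrite mulgKV eqxx mulr1 addr0.
case: eqP => [/(congr1 enum_val)|]; last by rewrite mulr0.
rewrite !gring_indexK ?groupM // => eq_y.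
by rewrite eq_y mulgK eqxx in zNyx.
Qed.

(* Maschke gives u G = f G for an idempotent f of the group algebra, and the
   scalar product of the characters is then the trace of the action of f. *)
Lemma cfdot_cyclic_regular (u : 'rV[algC]_#|G|) n
    (rho : mx_representation algC G n) :
  '[cfRepr (submod_repr (cyclic_mx_module aG u)), cfRepr rho]
    = (\rank (gring_mx rho u))%:R.
Proof.
set modU := cyclic_mx_module aG u; set U := cyclic_mx aG u in modU *.
have [W modW defUW dxUW] :=
  mx_Maschke_pchar aG (algC'G_pchar G) modU (submx1 U).
pose P := proj_mx U W; have UW0 : (U :&: W = 0)%MS by apply/mxdirect_addsP.
have homP x : x \in G -> aG x *m P = P *m aG x.
  move=> Gx; have domP : (1%:M <= dom_hom_mx aG P)%MS.
    by rewrite -defUW proj_mx_hom.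
  by have /hom_mxP/(_ x Gx) := domP; rewrite !mul1mx.
have sPU : (P <= U)%MS by rewrite -[P]mul1mx proj_mx_sub.
have idU m (V : 'M_(m, _)) : (V <= U)%MS -> V *m P = V by exact: proj_mx_id.
(* A projection commuting with right translations is left multiplication by the image [f] of the
   identity element. *)
clearbody P; pose f := gring_row P.
have mulP (v : 'rV_#|G|) : v *m P = f *m gring_mx aG v.
  have comm : gring_mx aG v *m P = P *m gring_mx aG v.
    rewrite gring_mx_sum mulmx_suml mulmx_sumr; apply: eq_bigr => x Gx.
    by rewrite -scalemxAl homP // scalemxAr.
  by rewrite -{1}(gring_mxK v) -gring_row_mul comm gring_row_mul.
have idf (v : 'rV_#|G|) : (v <= U)%MS -> v = f *m gring_mx aG v.
  by move=> vU; rewrite -mulP idU.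
have fU : (f <= U)%MS by exact: submx_trans (row_sub _ _) sPU.
have [A RA def_f] := cyclic_mxP fU.
have def_u := idf u (cyclic_mx_id aG u).
(* In the group algebra [u] is [f] times [u], and [f] is [u] times some element, so each rank bounds
   the other. *)
have eq_rank : \rank (gring_mx rho u) = \rank (gring_mx rho f).
  apply/eqP; rewrite eqn_leq; apply/andP; split.
    by rewrite def_u gring_mxA mxrankM_maxl.
  by rewrite def_f -(gring_rowK RA) gring_mxA mxrankM_maxl.
rewrite eq_rank -mxtrace_idempotent; last by rewrite -gring_mxA -idf.
(* The trace of [g] on [U] is the trace of [P] times [g] on the whole algebra, whose diagonal
   entries are coefficients of [f]. *)
have chiE g : g \in G -> cfRepr (submod_repr modU) g
    = \sum_(h in G) f 0 (idx (h * g^-1 * h^-1)%g).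
  move=> Gg; rewrite cfunE Gg mulr1n.
  have -> : \tr (submod_repr modU g) = \tr (P *m aG g).
    pose v1 : 'M_(\rank U, _) := val_submod (1%:M : 'M_(\rank U)).
    have sU : (v1 *m aG g <= U)%MS.
      move/mxmoduleP: (modU) => /(_ g Gg) modUg.
      by apply: submx_trans modUg; apply: submxMr; exact: val_submodP.
    rewrite -[submod_repr modU g]/(in_submod U (v1 *m aG g)) -(idU _ _ sU).
    have eqPv : P *m in_submod U 1%:M *m v1 = P.
      by rewrite -in_submodE -val_submodE in_submodK.
    rewrite in_submodE; move: (in_submod U 1%:M) eqPv => I1; clearbody v1 => eqPv.
    by rewrite -!mulmxA mxtrace_mulC -!mulmxA [P *m (_ *m _)]mulmxA eqPv homP.
  rewrite /mxtrace (reindex_onto idx (@enum_val gT G)) => [|i _]; last first.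
    by rewrite gring_valK.
  apply: eq_big => [h|h /eqP].
    apply/eqP/idP => [<-|Gh]; first exact: enum_valP.
    by rewrite gring_indexK.
  move=> Eh; have Gh : h \in G by rewrite -Eh; exact: enum_valP.
  have -> : (P *m aG g) (idx h) (idx h) = (row (idx h) (P *m aG g)) 0 (idx h).
    by rewrite [RHS]mxE.
  rewrite rowE mulmxA mulP gring_mx_delta // mul_row_regular //.
  by rewrite mul_row_regular ?groupM ?groupV.
rewrite cfdotE gring_mx_sum raddf_sum /=.
under eq_bigr => g Gg do rewrite chiE // mulr_suml.
rewrite exchange_big /=.
(* Conjugation by [h] is absorbed by reindexing over [g], so every [h] gives the same trace and
   their number cancels the factor 1/|G|. *)
have eq_h h : h \in G -> \sum_(g in G) f 0 (idx (h * g^-1 * h^-1)%g)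
     * ((cfRepr rho) g)^* = \sum_(x in G) \tr (f 0 (idx x) *: rho x).
  move=> Gh; rewrite (reindex_inj (@conjg_inj _ h)) /= (reindex_inj invg_inj) /=.
  apply: eq_big => [g|g Gg]; first by rewrite groupJr ?groupV.
  rewrite groupJr // groupV in Gg.
  rewrite cfunJ // conjVg invgK conjgE !mulgA mulgV mul1g mulgK mxtraceZ.
  by rewrite char_inv ?cfRepr_char // conjCK cfunE Gg mulr1n.
rewrite (eq_bigr _ eq_h) sumr_const -[X in _ * X]mulr_natl mulrA.
by rewrite mulVf ?mul1r // neq0CG.
Qed.

End RankCyclic.

(** * Cells of a shape and place permutations *)

Section Shape.
Local Open Scope nat_scope.
Variables (n : nat) (la : seq nat).
Hypotheses (la_sorted : sorted geq la) (la_sum : sumn la = n).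
Local Notation rw := (reshape_index la).
Local Notation co := (reshape_offset la).

Lemma nth_sorted_geq i j : i <= j -> nth 0 la j <= nth 0 la i.
Proof.
move=> le_ij; have [lt_j|ge_j] := ltnP j (size la); last by rewrite nth_default.
have := @sorted_leq_nth _ geq (fun y x z h1 h2 => leq_trans h2 h1) leqnn 0 la.
by apply => //; rewrite inE // (leq_ltn_trans le_ij).
Qed.

Lemma cell_inj (k l : nat) : rw k = rw l -> co k = co l -> k = l.
Proof. by move=> eq_r eq_c; rewrite -(reshape_indexK la k) eq_r eq_c
  reshape_indexK. Qed.

Lemma cell_above (k : 'I_n) i : i <= rw k ->
  exists l : 'I_n, rw l = i /\ co l = co k.
Proof.
move=> le_i; have lt_k : k < sumn la by rewrite la_sum.
have lt_c : co k < nth 0 la i.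
  exact: leq_trans (reshape_offsetP lt_k) (nth_sorted_geq le_i).
have lt_f : flatten_index la i (co k) < n by have := flatten_indexP lt_c;
  rewrite la_sum.
by exists (Ordinal lt_f); rewrite flatten_indexKl // flatten_indexKr.
Qed.

Lemma card_row i : #|[pred k : 'I_n | rw k == i]| = nth 0 la i.
Proof.
have lt_f (j : 'I_(nth 0 la i)) : flatten_index la i j < n.
  by have := flatten_indexP (ltn_ord j); rewrite la_sum.
rewrite -[RHS]card_ord -(card_imset _ (_ : injective (fun j => Ordinal (lt_f j)))).
  apply: eq_card => k; rewrite inE; apply/eqP/imsetP => [eq_i|[j _ ->]].
    have lt_k : k < sumn la by rewrite la_sum.
    have := reshape_offsetP lt_k; rewrite eq_i => lt_c.
    exists (Ordinal lt_c) => //.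
    by apply: val_inj; rewrite /= -eq_i reshape_indexK.
  by rewrite /= flatten_indexKl.
move=> j j' /(congr1 val) /= /(congr1 (reshape_offset la)).
by rewrite !flatten_indexKr // => /val_inj.
Qed.

Lemma col_lt (k l : nat) : co k = co l -> k < l -> rw k < rw l.
Proof.
move=> eq_c lt_kl; have := reshape_leq la l k; rewrite leqNgt lt_kl /=.
move/esym/negbT; rewrite negb_or -leqNgt leq_eqVlt => /andP[/orP[/eqP e|//]].
by rewrite e eqxx eq_c leqnn.
Qed.

Lemma row_leq (k l : nat) : k <= l -> rw k <= rw l.
Proof.
by rewrite (reshape_leq la) => /orP[/ltnW|/andP[/eqP->]].
Qed.

End Shape.

Section Stabilisers.
Local Open Scope group_scope.
Variables (n : nat) (f : 'I_n -> nat).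

Definition label_stab : {set 'S_n} := [set p : 'S_n | [forall k, f (p k) == f k]].

Lemma label_stabP (p : 'S_n) : reflect (forall k, f (p k) = f k) (p \in label_stab).
Proof. by rewrite inE; apply: (iffP forallP) => H k; apply/eqP. Qed.

Lemma label_stab_group_set : group_set label_stab.
Proof.
apply/group_setP; split=> [|p q /label_stabP fp /label_stabP fq].
  by apply/label_stabP => k; rewrite perm1.
by apply/label_stabP => k; rewrite permM fq fp.
Qed.
Canonical label_stab_group := group label_stab_group_set.

Lemma tperm_label_stab k l : f k = f l -> tperm k l \in label_stab.
Proof. by move=> eq_f; apply/label_stabP => m; case: tpermP => [->|->|//]. Qed.

End Stabilisers.

(** * Sorting a labelling along columns *)

Section ColumnSort.
Local Open Scope nat_scope.
Variables (n : nat) (mu : seq nat).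
Hypotheses (mu_sorted : sorted geq mu) (mu_sum : sumn mu = n).
Local Notation rw := (reshape_index mu).
Local Notation co := (reshape_offset mu).
Variable w : 'I_n -> nat.
Hypothesis w_inj : forall k l : 'I_n, co k = co l -> w k = w l -> k = l.

(** Among the column permutations, one maximizing the sum of row index times label works: swapping
    an inversion inside a column would increase that sum. *)
Lemma column_sort : exists2 q : 'S_n, q \in col_stab n mu &
  forall k l : 'I_n, co k = co l -> rw k < rw l -> w (q k) < w (q l).
Proof.
pose h (q : 'S_n) := \sum_(k : 'I_n) rw k * w (q k).
have C1 : (1%g : 'S_n) \in label_stab (fun k : 'I_n => co k) by exact: group1.
case: (arg_maxnP h C1) => q Cq q_max; exists q => // k l eq_c lt_r.
rewrite ltnNge leq_eqVlt; apply/negP => /orP[/eqP eq_w|lt_w].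
  have eq_kl : k = l.
    apply: (@perm_inj _ q); apply: w_inj => //.
    by move/label_stabP: Cq => Cq; rewrite !Cq.
  by rewrite eq_kl ltnn in lt_r.
have Ct : tperm k l \in label_stab (fun k : 'I_n => co k) by exact:
  tperm_label_stab.
have : h (tperm k l * q)%g <= h q by apply: q_max; exact: groupM.
rewrite leqNgt => /negP; apply.
have neq_lk : l != k by apply: contraTneq lt_r => ->; rewrite ltnn.
rewrite /h (bigD1 k) //= (bigD1 l) //= [ltnRHS](bigD1 k) //= [in ltnRHS](bigD1
  l) //=.
rewrite !permM tpermL tpermR !addnA.
rewrite [X in _ < _ + X](eq_bigr (fun m : 'I_n => rw m * w (q m))); last first.
  by move=> m /andP[mk ml]; rewrite permM tpermD // eq_sym.
rewrite ltn_add2r.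
move: lt_r lt_w; move: (w (q k)) (w (q l)) (rw k) (rw l) => a b r s lt_r lt_w.
rewrite -(subnKC (ltnW lt_r)) -(subnKC (ltnW lt_w)) !mulnDl !mulnDr.
have : 0 < (s - r) * (a - b) by rewrite muln_gt0 !subn_gt0 lt_r.
lia.
Qed.

(** Natural numbers increasing strictly down a column are at least the row index, since in a
    partition shape all cells above a given cell exist. *)
Lemma column_sort_ge : exists2 q : 'S_n, q \in col_stab n mu &
  forall k : 'I_n, rw k <= w (q k).
Proof.
have [q Cq lt_q] := column_sort; exists q => // k.
move: {2}(rw k) (erefl (rw k)) => i; elim: i k => [|i IH] k eq_i; rewrite eq_i //.
have [|l [rl cl]] := @cell_above n mu mu_sorted mu_sum k i; first by rewrite eq_i.
have := lt_q l k cl; rewrite rl eq_i => /(_ (ltnSn i)).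
by apply: leq_ltn_trans; rewrite -rl; apply: IH.
Qed.

End ColumnSort.

(** * Orthogonality of the Specht characters *)

Section YoungSymmetrizer.
Variables (n : nat) (la : seq nat).
Local Notation G := [set: 'S_n]%G.
Local Notation aG := (regular_repr algC G).

Definition row_sum_mx m (rho : mx_representation algC G m) : 'M_m :=
  \sum_(p in row_stab n la) rho p.
Definition col_sum_mx m (rho : mx_representation algC G m) : 'M_m :=
  \sum_(q in col_stab n la) (-1) ^+ q *: rho q.
Definition row_tabloid : 'rV[algC]_#|G| :=
  \sum_(p in row_stab n la) delta_mx 0 (gring_index G p).

Lemma gring_mx_polytabloid m (rho : mx_representation algC G m) :
  gring_mx rho (polytabloid n la) = row_sum_mx rho *m col_sum_mx rho.
Proof.
rewrite /polytabloid /row_sum_mx /col_sum_mx mulmx_sumr linear_sum.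
apply: eq_bigr => q _; rewrite mulmx_suml linear_sum; apply: eq_bigr => p _.
by rewrite linearZ /= gring_mx_delta ?inE // repr_mxM ?inE // scalemxAr.
Qed.

Lemma delta_regular x y :
  (delta_mx 0 (gring_index G x) : 'rV[algC]_#|G|) *m aG y =
  delta_mx 0 (gring_index G (x * y)%g).
Proof. by rewrite -rowE rowK gring_indexK ?inE. Qed.

Lemma polytabloid_tabloid : polytabloid n la = row_tabloid *m col_sum_mx aG.
Proof.
rewrite /polytabloid /row_tabloid /col_sum_mx mulmx_sumr.
apply: eq_bigr => q _; rewrite mulmx_suml; apply: eq_bigr => p _.
by rewrite -scalemxAr delta_regular.
Qed.

Lemma row_tabloidM p g : p \in row_stab n la ->
  row_tabloid *m aG (p * g)%g = row_tabloid *m aG g.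
Proof.
move=> Rp; rewrite /row_tabloid !mulmx_suml [RHS](reindex_inj (mulIg p)) /=.
apply: eq_big => [q|q _]; last by rewrite !delta_regular mulgA.
exact/esym/(groupMr (G := label_stab_group (fun k : 'I_n => reshape_index la k))).
Qed.

Lemma col_sum_mxM m (rho : mx_representation algC G m) t :
  t \in col_stab n la -> rho t *m col_sum_mx rho = (-1) ^+ t *: col_sum_mx rho.
Proof.
move=> Ct; rewrite /col_sum_mx mulmx_sumr scaler_sumr [RHS](reindex_inj (mulgI
  t)) /=.
apply: eq_big => [q|q _].
  exact/esym/(groupMl (G := label_stab_group (fun k : 'I_n => reshape_offset la
    k))).
rewrite -scalemxAr repr_mxM ?inE // scalerA odd_permM signr_addb mulrA.
by rewrite -signr_addb addbb mul1r.
Qed.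

End YoungSymmetrizer.

Lemma mxrank_submod_gring (gT : finGroupType) (G : {group gT}) m
    (rG : mx_representation algC G m) (U : 'M_m) (modU : mxmodule rG U)
    (u : 'rV[algC]_#|G|) :
  \rank (gring_mx (submod_repr modU) u) = \rank (U *m gring_mx rG u).
Proof.
have <- : \rank (val_submod (1%:M : 'M_(\rank U)) *m gring_mx rG u) = \rank (U
  *m gring_mx rG u).
  by apply: eqmx_rank; apply/eqmxP; apply: eqmxMr; apply: val_submod1.
have -> : val_submod (1%:M : 'M_(\rank U)) *m gring_mx rG u
          = val_submod (gring_mx (submod_repr modU) u).
  rewrite !gring_mx_sum mulmx_sumr [RHS]linear_sum; apply: eq_bigr => x Gx.
  by rewrite -scalemxAr [RHS]linearZ /= -[submod_mx modU x]mul1mx val_submodJ.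
by rewrite [in RHS]/val_submod /= mxrankMfree // row_base_free.
Qed.

(** * Scalar products of two Specht characters *)

Section SpechtDot.
Variables (n : nat) (mu la : seq nat).
Hypotheses (mu_sorted : sorted geq mu) (mu_sum : sumn mu = n).
Hypotheses (la_sorted : sorted geq la) (la_sum : sumn la = n).
Local Notation G := [set: 'S_n]%G.
Local Notation aG := (regular_repr algC G).
Local Notation weight la := (\sum_(k < n) reshape_index la k)%N.

(** The labels [w] are the rows of the entries in the translated tabloid. If two entries of one
    column of [mu] share a row, their transposition fixes the tabloid and negates the column sum, so
    the product is its own opposite. Otherwise the labels are distinct along columns and can be
    sorted. *)
Lemma tabloid_col_sum (g : 'S_n) :
  row_tabloid n la *m aG g *m col_sum_mx mu aG = 0 \/
  exists2 q : 'S_n, q \in col_stab n mu &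
    forall k : 'I_n, (reshape_index mu k <= reshape_index la (g^-1 (q k))%g)%N.
Proof.
pose w (k : 'I_n) := reshape_index la (g^-1 k)%g.
have [[k [l [eq_c eq_w neq]]]|inj_w] := pselect (exists k l : 'I_n,
   [/\ reshape_offset mu k = reshape_offset mu l, w k = w l & k <> l]).
  left; pose t := tperm k l.
  have Ct : t \in col_stab n mu by exact: (@tperm_label_stab _ _ k l eq_c).
  have Rt : (g * t * g^-1)%g \in row_stab n la.
    have -> : (g * t * g^-1 = t ^ g^-1)%g by rewrite conjgE invgK mulgA.
    by rewrite tpermJ; exact: (@tperm_label_stab _ _ (g^-1 k)%g (g^-1 l)%g eq_w).
  have eqA := row_tabloidM g Rt; rewrite mulgKV repr_mxM ?inE // mulmxA in eqA.
  set z := (X in X = 0); suff /eqP : z = - z.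
    by rewrite -addr_eq0 -mulr2n -scaler_nat scaler_eq0 pnatr_eq0 => /eqP.
  rewrite {1}/z -eqA -mulmxA col_sum_mxM // odd_tperm; case: eqP => // _.
  by rewrite -scalemxAr expr1 scaleN1r.
right; have [|q Cq ge_q] := @column_sort_ge n mu mu_sorted mu_sum w;
  last by exists q.
move=> k l eq_c eq_w; apply: contrapT => neq; apply: inj_w.
by exists k, l.
Qed.

(** The Specht module and its image under the row sum stay inside the span of the translated
    tabloids, so the image of the polytabloid is covered by the products in the hypothesis. *)
Lemma rank_specht_polytabloid p (W : 'M_(p, #|G|)) :
  (forall g, (row_tabloid n la *m aG g *m col_sum_mx mu aG <= W)%MS) ->
  (\rank (gring_mx (specht n la) (polytabloid n mu)) <= \rank W)%N.
Proof.
move=> subW; rewrite /specht mxrank_submod_gring gring_mx_polytabloid mulmxA.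
apply: mxrankS; set U := cyclic_mx _ _.
pose V := cyclic_mx aG (row_tabloid n la).
have modV : mxmodule aG V by exact: cyclic_mx_module.
have sum_in (P : pred 'S_n) (c : 'S_n -> algC) :
    (\sum_(q | P q) c q *: aG q \in enveloping_algebra_mx aG)%MS.
  rewrite linear_sum summx_sub // => q _; rewrite linearZ scalemx_sub //.
  by rewrite envelop_mx_id ?inE.
have sUV : (U <= V)%MS.
  rewrite /U polytabloid_tabloid; apply: cyclic_mx_sub => //.
  by rewrite (mxmodule_envelop modV) ?cyclic_mx_id // sum_in.
have sUV' : (U *m row_sum_mx mu aG <= V)%MS.
  rewrite (mxmodule_envelop modV) //.
  rewrite /row_sum_mx; under eq_bigr do rewrite -[aG _]scale1r.
  exact: sum_in.
apply: submx_trans (submxMr _ sUV') _.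
apply/row_subP => i; rewrite row_mul.
have /cyclic_mxP[A RA ->] := row_sub i V.
move: (row_tabloid n la) (col_sum_mx mu aG) subW => v Eb subW.
rewrite -(gring_rowK RA) gring_mx_sum mulmx_sumr mulmx_suml.
apply: summx_sub => g _; rewrite -scalemxAr -scalemxAl; exact: scalemx_sub.
Qed.

Lemma sum_label_perm (f : 'I_n -> nat) (s : 'S_n) :
  (\sum_k f (s k) = \sum_k f k)%N.
Proof. by rewrite [RHS](reindex_inj (@perm_inj _ s)). Qed.

(** Summing the sorted inequality over all cells would give the opposite comparison of weights. The
    weight is the statistic n(la), which reverses dominance; being a number, it compares any two
    shapes. *)
Lemma weight_le_rank :
  (weight la < weight mu)%N ->
  \rank (gring_mx (specht n la) (polytabloid n mu)) = 0%N.
Proof.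
move=> lt_w; apply/eqP; rewrite -leqn0 -(mxrank0 algC 1%N #|G|).
apply: rank_specht_polytabloid => g; have [->|[q _ ge_q]] := tabloid_col_sum g.
  exact: sub0mx.
have : (weight mu <= \sum_k reshape_index la ((q * g^-1)%g k))%N.
  by apply: leq_sum => k _; rewrite permM.
by rewrite (sum_label_perm (fun k : 'I_n => reshape_index la k)) leqNgt lt_w.
Qed.

Lemma weight_eq_labels (g q : 'S_n) : weight la = weight mu ->
  (forall k : 'I_n, (reshape_index mu k <= reshape_index la (g^-1 (q k))%g)%N) ->
  forall k : 'I_n, reshape_index la (g^-1 (q k))%g = reshape_index mu k.
Proof.
move=> eq_w ge_q k; apply/eqP; rewrite eqn_leq ge_q andbT leqNgt.
apply/negP => lt_k; suff : (weight mu < weight la)%N by rewrite eq_w ltnn.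
rewrite -(sum_label_perm (fun k : 'I_n => reshape_index la k) (q * g^-1)%g).
rewrite (bigD1 k) //= [ltnRHS](bigD1 k) //= -addSn permM leq_add //.
by apply: leq_sum => l _; rewrite permM.
Qed.

End SpechtDot.

(** At equal weights the row labels agree cell by cell up to a permutation, so corresponding rows
    have equal lengths; equal sizes rule out a difference in trailing zeros. *)
Lemma rank_specht_neq n (mu la : seq nat) :
    sorted geq mu -> sumn mu = n -> sorted geq la -> sumn la = n ->
    size la = size mu ->
    (\sum_(k < n) reshape_index la k <= \sum_(k < n) reshape_index mu k)%N ->
    la != mu ->
  \rank (gring_mx (specht n la) (polytabloid n mu)) = 0%N.
Proof.
move=> mu_s mu_n la_s la_n eq_sz; rewrite leq_eqVlt => /orP[/eqP eq_w|lt_w];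
  last first.
  by move=> _; apply: weight_le_rank.
move=> neq; apply/eqP; rewrite -leqn0 -(mxrank0 algC 1%N #|[set: 'S_n]%G|).
apply: rank_specht_polytabloid => g.
have [->|[q _ ge_q]] := tabloid_col_sum la mu_s mu_n g; first exact: sub0mx.
have eq_r := weight_eq_labels eq_w ge_q.
case/eqP: neq; apply: (@eq_from_nth _ 0%N) => // i _.
rewrite -(card_row la_n) -(card_row mu_n).
rewrite -[RHS](card_imset _ (@perm_inj _ (q * g^-1)%g)).
apply: eq_card => k; rewrite !inE.
apply/eqP/imsetP => [<-|[l]]; last first.
  by rewrite inE => /eqP <- ->; rewrite permM.
exists ((q * g^-1)^-1 k)%g; last by rewrite permKV.
by rewrite inE -eq_r -permM permKV.
Qed.

(** If a product is nonzero, the translating permutation is a row permutation times a column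
    permutation; the first fixes the tabloid and the second contributes a sign, so all products lie
    on one line. *)
Lemma rank_specht_eq n (la : seq nat) : sorted geq la -> sumn la = n ->
  (\rank (gring_mx (specht n la) (polytabloid n la)) <= 1)%N.
Proof.
move=> la_s la_n; pose aG := regular_repr algC [set: 'S_n]%G.
pose v := row_tabloid n la *m col_sum_mx la aG.
apply: leq_trans (rank_leq_row v); apply: rank_specht_polytabloid => // g.
have [->|[q Cq ge_q]] := tabloid_col_sum la la_s la_n g; first exact: sub0mx.
have eq_r := weight_eq_labels erefl ge_q.
have Rp : (g * q^-1)%g \in row_stab n la.
  apply/(@label_stabP _ (fun k : 'I_n => reshape_index la k)) => k.
  by rewrite permM -eq_r permKV permK.
have := row_tabloidM q Rp; rewrite mulgKV => ->.
by rewrite -mulmxA col_sum_mxM // -scalemxAr scalemx_sub.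
Qed.

(** Symmetry of the scalar product lets the shape of smaller weight provide the module and the other
    one the symmetrizer. A vanishing norm is left possible; [char_irr_or0] deals with it. *)
Lemma specht_orthonormal n (mu la : seq nat) :
    sorted geq mu -> sumn mu = n -> sorted geq la -> sumn la = n ->
    size la = size mu ->
  '[cfRepr (specht n mu), cfRepr (specht n la)] <= (la == mu)%:R.
Proof.
move=> mu_s mu_n la_s la_n eq_sz.
have [->|neq] := eqVneq la mu.
  by rewrite cfdot_cyclic_regular ler_nat rank_specht_eq.
have [le_w|/ltnW le_w] := leqP (\sum_(k < n) reshape_index la k)
                               (\sum_(k < n) reshape_index mu k).
  by rewrite cfdot_cyclic_regular rank_specht_neq.
by rewrite cfdotC_char ?cfRepr_char // cfdot_cyclic_regular rank_specht_neq //
  eq_sym.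
Qed.

(** * Semistandard fillings and permutation modules *)

Section PermRepr.
Variables (gT : finGroupType) (G : {group gT}) (X : finType).
Variable to : {action gT &-> X}.

Definition action_mx (g : gT) : 'M[algC]_#|X| :=
  \matrix_(i, j) (to (enum_val i) g == enum_val j)%:R.

Lemma row_action_mx i g :
  row i (action_mx g) = delta_mx 0 (enum_rank (to (enum_val i) g)).
Proof.
apply/rowP => j; rewrite !mxE eqxx /=; congr (_ %:R).
by rewrite -(inj_eq enum_val_inj) enum_rankK eq_sym.
Qed.

Lemma action_mx_repr : mx_repr G action_mx.
Proof.
split=> [|g h Gg Gh]; apply/row_matrixP => i.
  by rewrite row_action_mx row1 act1 enum_valK.
by rewrite row_mul !row_action_mx -rowE row_action_mx enum_rankK actM.
Qed.
Definition action_repr : mx_representation algC G #|X| :=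
  MxRepresentation action_mx_repr.

Lemma cfRepr_action g : g \in G ->
  cfRepr action_repr g = #|[set x | to x g == x]|%:R.
Proof.
move=> Gg; rewrite cfunE Gg mulr1n /mxtrace.
under eq_bigr do rewrite mxE.
rewrite (reindex_onto enum_rank enum_val) => [|i _]; last by rewrite enum_valK.
rewrite -sum1dep_card natr_sum [RHS]big_mkcond /=.
apply: eq_big => [x|x _]; first by rewrite enum_rankK eqxx.
by rewrite enum_rankK; case: eqP.
Qed.

End PermRepr.

(** In a linear relation between the rows indexed by [I], take a row with nonzero coefficient and
    maximal [h]: in its diagonal column no other row of the relation contributes. *)
Lemma rank_triangular (F : fieldType) (X : finType) (I : pred X) d
    (O : orderType d) (h : X -> O) (M : X -> X -> F) :
    {in I, forall x, M x x != 0} ->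
    {in I &, forall x y, M x y != 0 -> x = y \/ (h y < h x)%O} ->
  (#|I| <= \rank (\matrix_(i < #|X|, j < #|X|) M (enum_val i) (enum_val j)))%N.
Proof.
move=> M_diag M_tri; set A := \matrix_(i, j) _.
pose f (i : 'I_#|I|) := enum_rank (enum_val i : X).
have sub_rk : (\rank (rowsub f A) <= \rank A)%N.
  apply: mxrankS; apply/row_subP => i.
  have -> : row i (rowsub f A) = row (f i) A by apply/rowP => j; rewrite !mxE.
  exact: row_sub.
apply: leq_trans sub_rk; rewrite -[leqLHS]/(#|I|).
suff /eqP -> : row_free (rowsub f A) by [].
apply: inj_row_free => v v0; apply/eqP; apply: contraT => /rV0Pn[i0 vi0].
case: (@Order.TotalTheory.arg_maxP _ O _ i0 (fun i => v 0 i != 0)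
         (fun i => h (enum_val i)) vi0) => i vi i_max.
have /rowP/(_ (f i)) := v0; rewrite mxE [RHS]mxE (bigD1 i) //= big1 ?addr0.
  rewrite !mxE enum_rankK => /eqP; rewrite mulf_eq0 (negPf vi) /=.
  by rewrite (negPf (M_diag _ _)) //; exact: enum_valP.
move=> j neq_ji; rewrite !mxE !enum_rankK; apply/eqP; rewrite mulf_eq0 -implyNb.
apply/implyP => vj; apply: contraT => /M_tri[||/enum_val_inj eq_ji|lt_h].
- exact: enum_valP.
- exact: enum_valP.
- by rewrite eq_ji eqxx in neq_ji.
have : (h (enum_val j) <= h (enum_val i))%O by exact: i_max.
by rewrite leNgt lt_h.
Qed.

Lemma lexi_lt_nth (s t : seqlexi nat) (i : nat) : size s = size t ->
  (i < size t)%N ->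
    (forall j, (j < i)%N -> nth 0%N s j = nth 0%N t j) ->
    (nth 0%N s i < nth 0%N t i)%N ->
  (s < t)%O.
Proof.
elim: s t i => [|x s IH] [|y t] //= i [eq_sz] lt_i eq_j lt_xy.
rewrite Order.SeqLexiOrder.Exports.ltxi_cons.
case: i => [|i] in lt_i eq_j lt_xy *.
  by rewrite /= in lt_xy; rewrite !leEnat (ltnW lt_xy) leqNgt lt_xy.
have := eq_j 0%N isT => /= ->; rewrite lexx /=.
by apply: (IH t i) => // j lt_j; apply: (eq_j j.+1).
Qed.

Section SemistandardWords.
Variables (n : nat) (la : seq nat).
Hypotheses (la_sorted : sorted geq la) (la_sum : sumn la = n).
Local Notation G := [set: 'S_n]%G.
Local Notation rw := (reshape_index la).
Local Notation co := (reshape_offset la).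

Definition semistd (w : 'I_n -> nat) : bool :=
  [forall k : 'I_n, forall l : 'I_n,
     ((rw k == rw l) && (co k <= co l) ==> (w k <= w l)) &&
     ((co k == co l) && (rw k < rw l) ==> (w k < w l))]%N.

Lemma semistdP w : reflect
  ((forall k l : 'I_n, rw k = rw l -> co k <= co l -> w k <= w l)%N /\
   (forall k l : 'I_n, co k = co l -> rw k < rw l -> w k < w l)%N) (semistd w).
Proof.
apply: (iffP forallP) => [ss|[ssr ssc] k].
  split=> k l e le; have /forallP/(_ l)/andP[/implyP h1 /implyP h2] := ss k.
    by apply: h1; rewrite e eqxx.
  by apply: h2; rewrite e eqxx.
apply/forallP => l; apply/andP; split; apply/implyP => /andP[/eqP e le].
  exact: ssr k l e le.
exact: ssc.
Qed.

(** The key for triangularity: it ignores row permutations, and a nontrivial column permutation that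
    ends at a semistandard filling lowers it lexicographically. *)
Definition row_sums (w : 'I_n -> nat) : seqlexi nat :=
  [seq (\sum_(k < n | rw k == i) w k)%N | i <- iota 0 (size la)].

Lemma row_sums_stab p w : p \in row_stab n la -> row_sums (w \o p) = row_sums w.
Proof.
move/(@label_stabP _ (fun k : 'I_n => rw k)) => Rp.
apply: eq_map => i; rewrite [RHS](reindex_inj (@perm_inj _ p)) /=.
by apply: eq_bigl => k; rewrite Rp.
Qed.

(** For every c, both fillings have equally many entries at most c in each row. If they differed at
    a cell, the smaller of the two entries there, taken as c, would make one set of such cells
    strictly contained in the other. *)
Lemma eq_row_sorted (w w' : 'I_n -> nat) p : p \in row_stab n la ->
    (forall k l : 'I_n, rw k = rw l -> co k <= co l -> w k <= w l)%N ->
    (forall k l : 'I_n, rw k = rw l -> co k <= co l -> w' k <= w' l)%N ->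
    (forall k, w' k = w (p k)) ->
  w' =1 w.
Proof.
move=> Rp w_s w'_s eq_w.
have Rp' := Rp; move/(@label_stabP _ (fun k : 'I_n => rw k)) in Rp'.
have card_eq (k : 'I_n) c : #|[pred l : 'I_n | (rw l == rw k) && (w' l <= c)%N]|
                 = #|[pred l : 'I_n | (rw l == rw k) && (w l <= c)%N]|.
  rewrite -(card_imset _ (@perm_inj _ p)).
  apply: eq_card => l; rewrite !inE; apply/imsetP/idP => [[m]|lP].
    by rewrite inE eq_w => mP ->; rewrite Rp'.
  exists (p^-1 l)%g; last by rewrite permKV.
  by rewrite inE eq_w permKV -[rw (p^-1 _)%g]Rp' permKV.
have lt_absurd (u u' : 'I_n -> nat) (k : 'I_n) :
    (forall k l : 'I_n, rw k = rw l -> co k <= co l -> u k <= u l)%N ->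
    (forall k l : 'I_n, rw k = rw l -> co k <= co l -> u' k <= u' l)%N ->
    #|[pred l : 'I_n | (rw l == rw k) && (u' l <= u k)%N]|
      = #|[pred l : 'I_n | (rw l == rw k) && (u l <= u k)%N]| ->
  (u' k <= u k)%N.
  move=> u_s u'_s eq_card; rewrite leqNgt; apply/negP => lt_k.
  suff : (#|[pred l : 'I_n | (rw l == rw k) && (u' l <= u k)%N]|
          < #|[pred l : 'I_n | (rw l == rw k) && (u l <= u k)%N]|)%N.
    by rewrite eq_card ltnn.
  apply: proper_card; apply/fintype.properP; split.
    apply/fintype.subsetP => l; rewrite !inE => /andP[/eqP e le_l];
      rewrite e eqxx /=.
    apply: u_s => //; rewrite leqNgt; apply/negP => lt_c.
    have := u'_s k l (esym e) (ltnW lt_c).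
    by rewrite leqNgt (leq_ltn_trans le_l lt_k).
  by exists k; rewrite !inE eqxx //= -ltnNge.
move=> k; apply/eqP; rewrite eqn_leq (lt_absurd w w') //=.
exact/lt_absurd.
Qed.

Variables (X : finType) (to : {action 'S_n &-> X}) (wd : X -> 'I_n -> nat).
Hypothesis wd_act : forall x g k, wd (to x g) k = wd x (g^-1 k)%g.
Hypothesis wd_inj : forall x y, wd x =1 wd y -> x = y.

Definition symmetrizer_coef x y : algC :=
  \sum_(q in col_stab n la) \sum_(p in row_stab n la)
    (-1) ^+ q * (to x (p * q)%g == y)%:R.

Lemma gring_action_polytabloid :
  gring_mx (action_repr G to) (polytabloid n la) =
    \matrix_(i, j) symmetrizer_coef (enum_val i) (enum_val j).
Proof.
apply/matrixP => i j; rewrite /polytabloid linear_sum summxE mxE.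
apply: eq_bigr => q _; rewrite linear_sum summxE; apply: eq_bigr => p _.
by rewrite linearZ /= gring_mx_delta ?inE // !mxE.
Qed.

(** Let [k0] be the first cell moved by [q]. Earlier cells are fixed, so earlier row sums agree. As
    columns are preserved, [q] moves [k0] to a lower row and no cell of its row upwards, so the sum
    of that row is smaller for [y]. *)
Lemma symmetrizer_term x y p q : semistd (wd x) -> semistd (wd y) ->
    p \in row_stab n la -> q \in col_stab n la -> to x (p * q)%g = y ->
  (q = 1%g /\ x = y) \/ (row_sums (wd y) < row_sums (wd x))%O.
Proof.
move=> /semistdP[xr xc] /semistdP[yr yc] Rp Cq def_y.
have eq_xy k : wd y (q k) = wd x (p^-1 k)%g.
  by rewrite -def_y wd_act invMg permM permK.
have Rp1 : (p^-1)%g \in row_stab n la.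
  exact/(groupVr (G := label_stab_group (fun k : 'I_n => rw k))).
have [q1|q1] := eqVneq q 1%g.
  left; split=> //; apply: wd_inj; apply: fsym.
  apply: (eq_row_sorted Rp1) => // k.
  by rewrite -eq_xy q1 perm1.
right; have /(@label_stabP _ (fun k : 'I_n => co k)) Cq' := Cq.
have [k1 qk1] : exists k, q k != k.
  apply/existsP; apply: contraR q1; rewrite negb_exists => /forallP h.
  by apply/eqP/permP => k; rewrite perm1; apply/eqP; rewrite -[_ == _]negbK.
case: (@arg_minnP _ k1 (fun k => q k != k) (fun k : 'I_n => val k) qk1) => k0
  qk0 k0_min {k1 qk1}.
have ge_q (k : 'I_n) : (k0 <= k)%N -> (k0 <= q k)%N.
  move=> le_k; have [/eqP fix_k|] := boolP (q (q k) == q k).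
    by move/perm_inj: fix_k => ->.
  exact: k0_min.
have fix_lt (k : 'I_n) : (k < k0)%N -> q k = k.
  move=> lt_k; apply/eqP; apply: contraTT lt_k => /k0_min; by rewrite -leqNgt.
have rw_q (k : 'I_n) : (rw k <= rw k0)%N -> (rw k <= rw (q k))%N.
  move=> le_r; have [/fix_lt ->//|/ge_q] := ltnP k k0.
  by move/(row_leq la)/(leq_trans le_r).
have wd_q (k : 'I_n) : (rw k <= rw k0)%N -> (wd y k <= wd y (q k))%N.
  move/rw_q; rewrite leq_eqVlt => /orP[/eqP e|lt_r].
    suff -> : q k = k by [].
    by apply: val_inj; apply: (@cell_inj la); rewrite ?Cq'.
  by apply/ltnW/yc; rewrite ?Cq'.
rewrite -(row_sums_stab (wd x) Rp1).
have lt_k0 : (k0 < sumn la)%N by rewrite la_sum.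
apply: (@lexi_lt_nth _ _ (rw k0)).
- by rewrite !size_map.
- by rewrite size_map size_iota reshape_indexP.
- move=> i lt_i; have lt_sz : (i < size la)%N.
    exact: ltn_trans lt_i (reshape_indexP lt_k0).
  rewrite !(nth_map 0%N) ?size_iota // nth_iota // add0n.
  apply: eq_bigr => k /eqP eq_i; rewrite /= -eq_xy fix_lt //.
  rewrite ltnNge; apply: contraL lt_i => /(row_leq la).
  by rewrite eq_i -leqNgt.
have lt_sz := reshape_indexP lt_k0.
rewrite !(nth_map 0%N) ?size_iota // nth_iota // add0n.
rewrite (bigD1 k0) //= [ltnRHS](bigD1 k0) //= -addSn leq_add //.
  rewrite -eq_xy; apply: yc; first by rewrite Cq'.
  apply: (@col_lt la); first by rewrite Cq'.
  by rewrite ltn_neqAle ge_q // andbT eq_sym.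
by apply: leq_sum => k /andP[/eqP eq_r _]; rewrite -eq_xy wd_q // eq_r.
Qed.

Lemma semistd_le_rank :
  (#|[pred x | semistd (wd x)]|
     <= \rank (gring_mx (action_repr G to) (polytabloid n la)))%N.
Proof.
rewrite gring_action_polytabloid.
apply: (@rank_triangular _ _ _ _ _ (fun x => row_sums (wd x))) => [x|x y];
  rewrite !inE.
  (* On the diagonal only the trivial column permutation contributes; its terms are nonnegative and
     the one at p = 1 is 1. *)
  move=> ssx; rewrite /symmetrizer_coef (bigD1 1%g) /=; last first.
    exact: (group1 (label_stab_group (fun k : 'I_n => co k))).
  rewrite [X in _ + X]big1 => [|q /andP[Cq q1]]; last first.
    apply: big1 => p Rp; case: eqP => [|_]; last by rewrite mulr0.
    case/(symmetrizer_term ssx ssx Rp Cq) => [[eq_q _]|].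
      by rewrite eq_q eqxx in q1.
    by rewrite ltxx.
  rewrite addr0 odd_perm1; under eq_bigr do rewrite mul1r.
  rewrite -natr_sum pnatr_eq0 -lt0n (bigD1 1%g) /=; last first.
    exact: (group1 (label_stab_group (fun k : 'I_n => rw k))).
  by rewrite mulg1 act1 eqxx.
move=> ssx ssy nz.
have [[q [p [Cq Rp eq_y]]]|none] := pselect (exists q p, [/\ q \in col_stab n la,
    p \in row_stab n la & to x (p * q)%g = y]).
  by have [[_ ?]|?] := symmetrizer_term ssx ssy Rp Cq eq_y; [left|right].
case/eqP: nz; apply: big1 => q Cq; apply: big1 => p Rp.
case: eqP => [eq_y|_]; last by rewrite mulr0.
by case: none; exists q, p.
Qed.

End SemistandardWords.

(** * Robinson-Schensted-Knuth insertion *)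

Section RSK.
Implicit Types (r q : seq nat) (T Q : seq (seq nat)).
Local Open Scope nat_scope.

Definition row_insert r x : seq nat * option nat :=
  let j := find (ltn x) r in
  if j < size r then (set_nth 0 r j x, Some (nth 0 r j)) else (rcons r x, None).

(* Inserts x into the tableau T and m into the recording tableau Q, at the place
   where the shape of T grows. *)
Fixpoint rsk_insert T Q x m : seq (seq nat) * seq (seq nat) :=
  match T, Q with
  | r :: T', q :: Q' =>
      match row_insert r x with
      | (r', None) => (r' :: T', rcons q m :: Q')
      | (r', Some y) => let: (A, B) := rsk_insert T' Q' y m in (r' :: A, q :: B)
      end
  | _, _ => ([:: [:: x]], [:: [:: m]])
  end.

(** Insertion runs from the last letter to the first, following the structure of the list; the
    recorded labels are 0, ..., n - 1 in order of insertion. *)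
Fixpoint rsk (w : seq nat) : seq (seq nat) * seq (seq nat) :=
  if w is x :: w' then
    let: (T, Q) := rsk w' in rsk_insert T Q x (size w')
  else ([::], [::]).

Variant row_insert_spec r x : seq nat * option nat -> Prop :=
| RowAppend of all (fun y => y <= x) r :
    row_insert_spec r x (rcons r x, None)
| RowBump a y b of r = a ++ y :: b & all (fun z => z <= x) a & x < y :
    row_insert_spec r x (a ++ x :: b, Some y).

Lemma row_insertP r x : row_insert_spec r x (row_insert r x).
Proof.
rewrite /row_insert; case: ifPn => [lt_j|].
  have has_r : has (ltn x) r by rewrite has_find.
  have lt_x := nth_find 0 has_r; set j := find _ r in lt_j lt_x *.
  rewrite set_nthE lt_j; apply: RowBump => //.
    by rewrite -drop_nth // cat_take_drop.
  apply/(all_nthP 0) => i; rewrite size_take lt_j => lt_i; rewrite nth_take //.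
  by have := before_find 0 lt_i; rewrite /= ltnNge => /negbFE.
rewrite -has_find => no; apply: RowAppend.
apply/allP => y y_r; rewrite leqNgt; apply: contra no => lt_y.
by apply/hasP; exists y.
Qed.

Definition dom r q :=
  (size q <= size r) && all (fun j => nth 0 r j < nth 0 q j) (iota 0 (size q)).

Lemma domP r q : reflect
  (size q <= size r /\ forall j, j < size q -> nth 0 r j < nth 0 q j) (dom r q).
Proof.
apply: (iffP andP) => [[h /allP lt]|[h lt]]; split=> //.
  by move=> j lt_j; apply: lt; rewrite mem_iota.
by apply/allP => j; rewrite mem_iota; apply: lt.
Qed.

Definition tableau T :=
  [&& all (fun r => 0 < size r) T, all (sorted leq) T & sorted dom T].

Lemma sorted_cat_cons a y b : sorted leq (a ++ y :: b) =
  [&& sorted leq a, all (fun z => z <= y) a, all (leq y) b & sorted leq b].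
Proof.
rewrite !(sorted_pairwise leq_trans) pairwise_cat /= allrel_consr.
rewrite -!andbA; apply/and4P/and4P.
  by case=> h1 _ h2 /andP[h3 h4].
case=> h1 h2 h3 h4; split=> //; last by rewrite h3.
apply/allrelP => u v u_a v_b.
exact: leq_trans (allP h2 u u_a) (allP h3 v v_b).
Qed.

Lemma sorted_row_insert r x : sorted leq r -> sorted leq (row_insert r x).1.
Proof.
case: row_insertP => [le_x|a y b -> le_x lt_x] /=.
  by rewrite -cats1 sorted_cat_cons => ->; rewrite le_x.
rewrite !sorted_cat_cons le_x => /and4P[-> _ le_b ->]; rewrite andbT /=.
by apply/allP => z /(allP le_b); apply: leq_trans; apply: ltnW.
Qed.

(* The bumped entry y comes to lie in a column weakly to the left of its old one. *)
Lemma dom_row_insert r x y q : sorted leq r -> dom r q ->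
  (row_insert r x).2 = Some y -> dom (row_insert r x).1 (row_insert q y).1.
Proof.
case: row_insertP => [//|a z b -> le_x lt_x] + /domP[le_sz lt] [<-{y}] /=.
rewrite sorted_cat_cons => /and4P[_ le_z _ _].
have sz_a : nth 0 (a ++ z :: b) (size a) = z by rewrite nth_cat ltnn subnn.
have nth_ne j : j != size a -> nth 0 (a ++ x :: b) j = nth 0 (a ++ z :: b) j.
  move=> neq; rewrite !nth_cat; case: ltnP => // le_j.
  have : 0 < j - size a by rewrite subn_gt0 ltn_neqAle eq_sym neq.
  by case: (j - size a).
have nth_le j : j <= size a -> nth 0 (a ++ x :: b) j <= x.
  rewrite leq_eqVlt nth_cat => /orP[/eqP ->|lt_j]; first by rewrite ltnn subnn.
  by rewrite lt_j; exact: (allP le_x _ (mem_nth _ lt_j)).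
have sz_eq : size (a ++ x :: b) = size (a ++ z :: b) by rewrite !size_cat.
have lt' j : j < size q -> nth 0 (a ++ x :: b) j < nth 0 q j.
  have [->|neq] := eqVneq j (size a); last by rewrite nth_ne //; apply: lt.
  by move/lt; rewrite sz_a nth_cat ltnn subnn; apply: ltn_trans.
case: row_insertP => [le_q|c u d eq_q le_q lt_u] /=.
  have le_qa : size q <= size a.
    rewrite leqNgt; apply/negP => lt_a; have := lt _ lt_a; rewrite sz_a.
    by rewrite ltnNge (allP le_q _ (mem_nth _ lt_a)).
  apply/domP; split; first by rewrite size_rcons sz_eq size_cat /= addnS ltnS
    (leq_trans le_qa) ?leq_addr.
  move=> j; rewrite size_rcons ltnS nth_rcons leq_eqVlt => /orP[/eqP ->|lt_j].
    by rewrite ltnn eqxx; apply: leq_ltn_trans lt_x; apply: nth_le.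
  by rewrite lt_j; apply: lt'.
have le_ca : size c <= size a.
  rewrite leqNgt; apply/negP => lt_a.
  have lt_aq : size a < size q by rewrite eq_q size_cat ltn_addr.
  have := lt _ lt_aq; rewrite sz_a eq_q nth_cat lt_a.
  by rewrite ltnNge (allP le_q _ (mem_nth _ lt_a)).
apply/domP; split; first by rewrite sz_eq size_cat /= -[_ + _]/(size c + size
  (u :: d)) -size_cat -eq_q.
move=> j lt_j; have [->|neq] := eqVneq j (size c).
  rewrite [ltnRHS]nth_cat ltnn subnn /=; apply: leq_ltn_trans lt_x.
  exact: nth_le.
have lt_jq : j < size q by rewrite eq_q size_cat /=; rewrite size_cat /= in lt_j.
apply: leq_trans (lt' j lt_jq) _; rewrite eq_q !nth_cat; case: ltnP => // le_j.
have : 0 < j - size c by rewrite subn_gt0 ltn_neqAle eq_sym neq.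
by case: (j - size c).
Qed.

Lemma dom_head_insert r x y T Q m : sorted leq r -> path dom r T ->
    shape T = shape Q -> (row_insert r x).2 = Some y ->
  dom (row_insert r x).1 (head [::] (rsk_insert T Q y m).1).
Proof.
case: T Q => [|r1 T] [|q1 Q] //= r_s.
  move=> _ _ eq_y; apply: (@dom_row_insert r x y [::]) => //.
case/andP=> dom_r _ _ /(dom_row_insert r_s dom_r).
by case: (row_insert r1 y) => r1' [z|] //=; case: rsk_insert.
Qed.

Lemma rsk_insert_cons T Q x m : exists r A q B,
  rsk_insert T Q x m = (r :: A, q :: B).
Proof.
case: T Q => [|r T] [|q Q] /=; try by do 4!eexists.
case: row_insert => r' [y|]; last by do 4!eexists.
by case: rsk_insert => A B; do 4!eexists.
Qed.

Lemma shape_rsk_insert T Q x m : shape T = shape Q ->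
  shape (rsk_insert T Q x m).1 = shape (rsk_insert T Q x m).2.
Proof.
elim: T Q x => [|r T IH] [|q Q] x //= [eq_r eq_sh].
case: row_insertP => [_|a y b -> _ _] in eq_r *.
  by rewrite /= !size_rcons eq_r eq_sh.
have := IH Q y eq_sh; case: rsk_insert => A B /= ->.
by rewrite -eq_r !size_cat.
Qed.

Lemma perm_rsk_insertl T Q x m : shape T = shape Q ->
  perm_eq (flatten (rsk_insert T Q x m).1) (x :: flatten T).
Proof.
elim: T Q x => [|r T IH] [|q Q] x //= [eq_r eq_sh].
case: row_insertP => [_|a y b -> _ _];
  first by rewrite /= cat_rcons -cat1s perm_catCA.
have := IH Q y eq_sh; case: rsk_insert => A B /= permA.
rewrite -!catA /= -[x :: a ++ _]cat1s -[x :: b ++ _]cat1s perm_catCA perm_cat2l.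
by rewrite perm_cat2l -[y :: b ++ _]cat1s perm_sym perm_catCA perm_cat2l perm_sym.
Qed.

Lemma perm_rsk_insertr T Q x m : shape T = shape Q ->
  perm_eq (flatten (rsk_insert T Q x m).2) (m :: flatten Q).
Proof.
elim: T Q x => [|r T IH] [|q Q] x //= [eq_r eq_sh].
case: row_insertP => [_|a y b _ _ _];
  first by rewrite /= cat_rcons -[m :: flatten Q]cat1s perm_catCA.
have := IH Q y eq_sh; case: rsk_insert => A B /= permB.
by rewrite -[m :: _]cat1s perm_sym perm_catCA perm_cat2l perm_sym.
Qed.

Lemma tableau_rsk_insert T Q x m : shape T = shape Q ->
  tableau T -> tableau (rsk_insert T Q x m).1.
Proof.
rewrite /tableau.
elim: T Q x => [|r T IH] [|q Q] x //= [eq_r eq_sh].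
case/and3P=> /andP[r_gt0 T_gt0] /andP[r_s T_s] dom_T.
have T_dom := path_sorted dom_T.
have := fun y => @dom_head_insert r x y T Q m r_s dom_T eq_sh.
have := sorted_row_insert x r_s.
case: row_insertP => [le_x|a y b def_r le_x lt_x] /= r'_s.
  move=> _; rewrite size_rcons T_gt0 r'_s T_s /=.
  case: T dom_T {IH eq_sh T_gt0 T_s T_dom} => //= r1 T /andP[/domP[le_sz lt] ->].
  rewrite andbT; apply/domP; split=> [|j lt_j]; first by rewrite size_rcons ltnW.
  by rewrite nth_rcons (leq_trans lt_j le_sz) lt.
move/(_ y erefl); have := IH Q y eq_sh; rewrite T_gt0 T_s T_dom => /(_ isT).
have [r1 [A [q1 [B ->]]]] := rsk_insert_cons T Q y m.
move=> /= /and3P[-> -> ->] ->; rewrite r'_s.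
by rewrite size_cat /= addnS.
Qed.

(** The label [m] exceeds all others and ends its row, so the only danger is a row longer than the
    one above it. The hypothesis on the shape excludes this; it comes from the insertion tableau,
    which has the same shape. *)
Lemma tableau_rsk_insertr T Q x m : shape T = shape Q ->
    all (fun z => z < m) (flatten Q) -> sorted geq (shape (rsk_insert T Q x m).2) ->
  tableau Q -> tableau (rsk_insert T Q x m).2.
Proof.
rewrite /tableau.
elim: T Q x => [|r T IH] [|q Q] x //= [eq_r eq_sh].
rewrite all_cat => /andP[q_lt Q_lt] + /and3P[/andP[q_gt0 Q_gt0] /andP[q_s Q_s]
  dom_Q].
have Q_dom := path_sorted dom_Q.
case: row_insertP => [le_x _|a y b def_r le_x lt_x] /=.
  rewrite size_rcons Q_gt0 Q_s -cats1 sorted_cat_cons q_s /= !andbT.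
  apply/andP; split; first by apply/allP => z /(allP q_lt) /ltnW.
  case: Q dom_Q {IH eq_sh Q_gt0 Q_s Q_dom Q_lt} => //= r1 Q /andP[/domP[le_sz
    lt] ->].
  rewrite andbT; apply/domP; split=> [|j lt_j];
    first by rewrite cats1 size_rcons ltnW.
  by rewrite nth_cat (leq_trans lt_j le_sz) lt.
have := IH Q y eq_sh Q_lt; rewrite Q_gt0 Q_s Q_dom.
have dom_rcons q1 : dom q q1 -> size q1 < size q -> dom q (rcons q1 m).
  move/domP=> [le_sz lt] lt_sz; apply/domP; rewrite size_rcons; split=> // j.
  rewrite ltnS leq_eqVlt nth_rcons => /orP[/eqP ->|lt_j]; last by rewrite lt_j lt.
  by rewrite ltnn eqxx; apply: (allP q_lt); apply: mem_nth.
have : (size (head [::] (rsk_insert T Q y m).2) <= size q) ->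
    dom q (head [::] (rsk_insert T Q y m).2).
  case: T Q dom_Q eq_sh {IH Q_lt Q_gt0 Q_s Q_dom} => [|r1 T] [|q1 Q] //= dom_Q.
    by move=> _ sz; apply: (@dom_rcons [::]).
  case/andP: dom_Q => dom_q _ _.
  case: (row_insert r1 y) => r' [z|] /=; first by case: rsk_insert.
  by rewrite size_rcons; apply: dom_rcons.
have [r1 [A [q1 [B ->]]]] := rsk_insert_cons T Q y m.
move=> /= dom_q IH' /andP[/dom_q -> /IH' /(_ isT)/and3P[-> -> ->]].
by rewrite q_gt0 q_s.
Qed.

(** Reverse bumping: [x] stands at the last position of the new row whose entry is below the bumped
    one. *)
Lemma row_insert_inj r x r1 x1 y : sorted leq r -> sorted leq r1 ->
    (row_insert r x).2 = Some y -> row_insert r x = row_insert r1 x1 ->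
  r = r1 /\ x = x1.
Proof.
case: row_insertP => [//|a z b -> le_a lt_z].
case: row_insertP => [//|a1 z1 b1 -> le_a1 lt_z1] + + _ [+ eq_z].
rewrite -{}eq_z !sorted_cat_cons in lt_z1 *.
move=> /and4P[_ le_az le_zb _] /and4P[_ le_az1 le_zb1 _] eq_r.
suff sz : size a = size a1.
  have /andP[/eqP -> /eqP[-> ->]] : (a == a1) && (x :: b == x1 :: b1).
    by rewrite -eqseq_cat // eq_r.
  by [].
have bound u v c d u' v' : u ++ v :: c = u' ++ v' :: d ->
    v' < z -> all (leq z) c -> size u' <= size u.
  move=> e lt_v' le_c; rewrite leqNgt; apply/negP => lt_u.
  have := congr1 (fun s => nth 0 s (size u')) e.
  rewrite !nth_cat ltnn subnn ltnNge (ltnW lt_u) /=.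
  case eq_i: (size u' - size u) => [|i] /=.
    by move/eqP: eq_i; rewrite subn_eq0 leqNgt lt_u.
  have lt_i : i < size c.
    have := congr1 size e; rewrite !size_cat /=; lia.
  by move=> e'; have := allP le_c _ (mem_nth 0 lt_i); rewrite e' leqNgt lt_v'.
by apply/eqP; rewrite eqn_leq (bound _ _ _ _ _ _ (esym eq_r)) //= (bound _ _ _
  _ _ _ eq_r).
Qed.

(** The largest label [m] shows in which row the insertion ended; the bumps above it are undone by
    [row_insert_inj]. *)
Lemma rsk_insert_inj T Q x T1 Q1 x1 m :
    shape T = shape Q -> shape T1 = shape Q1 ->
    all (fun r => 0 < size r) T -> all (fun r => 0 < size r) T1 ->
    all (sorted leq) T -> all (sorted leq) T1 ->
    all (fun z => z < m) (flatten Q) -> all (fun z => z < m) (flatten Q1) ->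
  rsk_insert T Q x m = rsk_insert T1 Q1 x1 m -> [/\ T = T1, Q = Q1 & x = x1].
Proof.
elim: T Q T1 Q1 x x1 => [|r T IH] [|q Q] [|r1 T1] [|q1 Q1] x x1 //=.
- by move=> _ _ _ _ _ _ _ _ [].
- move=> _ [eq_sz _] _ /andP[r1_gt0 _] _ _ _; rewrite all_cat => /andP[q1_lt _].
  case: (row_insert r1 x1) => r' [y|]; last first.
    case=> _ _ eq_q _; have q1_nil : q1 = [::] by case: (q1) eq_q => [|? []].
    by rewrite eq_sz q1_nil in r1_gt0.
  case: (rsk_insert T1 Q1 y m) => A B [_ _ eq_q _].
  by rewrite -eq_q /= ltnn in q1_lt.
- move=> [eq_sz _] _ /andP[r_gt0 _] _ _ _; rewrite all_cat => /andP[q_lt _] _.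
  case: (row_insert r x) => r' [y|]; last first.
    case=> _ _ eq_q _; have q_nil : q = [::] by case: (q) eq_q => [|? []].
    by rewrite eq_sz q_nil in r_gt0.
  case: (rsk_insert T Q y m) => A B [_ _ eq_q _].
  by rewrite eq_q /= ltnn in q_lt.
move=> [eq_r eq_sh] [eq_r1 eq_sh1] /andP[_ T_gt0] /andP[_ T1_gt0].
move=> /andP[r_s T_s] /andP[r1_s T1_s]; rewrite !all_cat.
move=> /andP[q_lt Q_lt] /andP[q1_lt Q1_lt].
have not_rcons u v : all (fun z => z < m) v -> rcons u m <> v.
  by move=> lt_v e; move: lt_v; rewrite -e all_rcons ltnn.
case eq_i: (row_insert r x) => [r' o]; case eq_i1: (row_insert r1 x1) => [r1' o1].
case: o o1 => [y|] [y1|] in eq_i eq_i1 *.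
- case eqA: (rsk_insert T Q y m) => [A B];
  case eqA1: (rsk_insert T1 Q1 y1 m) => [A1 B1].
  case=> eq_r' eq_A eq_q eq_B; subst A1 B1.
  rewrite -eqA1 in eqA.
  have [-> -> eq_y] := IH _ _ _ _ _ eq_sh eq_sh1 T_gt0 T1_gt0 T_s T1_s Q_lt
    Q1_lt eqA.
  subst y1; have [||-> ->] := @row_insert_inj r x r1 x1 y r_s r1_s.
  + by rewrite eq_i.
  + by rewrite eq_i eq_i1 eq_r'.
  by rewrite eq_q.
- by case: rsk_insert => A B [_ _ /esym/(not_rcons _ _ q_lt)].
- by case: rsk_insert => A B [_ _ /(not_rcons _ _ q1_lt)].
case=> eq_r' -> /rcons_inj[-> ->]; split=> //.
  move: eq_i eq_i1; case: row_insertP => // _ [e]; case: row_insertP => // _ [e1].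
  by move: eq_r'; rewrite -e -e1 => /rcons_inj[->].
move: eq_i eq_i1; case: row_insertP => // _ [e]; case: row_insertP => // _ [e1].
by move: eq_r'; rewrite -e -e1 => /rcons_inj[].
Qed.

Lemma tableau_shape T : tableau T -> sorted geq (shape T).
Proof.
case/and3P=> _ _; rewrite /shape sorted_map; apply: sub_sorted => r q.
by case/andP.
Qed.

Lemma rskP w (T := (rsk w).1) (Q := (rsk w).2) :
  [/\ shape T = shape Q, tableau T, tableau Q, perm_eq (flatten T) w
    & perm_eq (flatten Q) (iota 0 (size w))].
Proof.
rewrite {}/T {}/Q; elim: w => [|x w] //=.
case: (rsk w) => T Q /= [eq_sh T_tab Q_tab permT permQ].
have Q_lt : all (fun z => z < size w) (flatten Q).
  by rewrite (perm_all _ permQ); apply/allP => z; rewrite mem_iota.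
have eq_sh' := shape_rsk_insert x (size w) eq_sh.
have T'_tab := tableau_rsk_insert x (size w) eq_sh T_tab.
split=> //.
- apply: tableau_rsk_insertr => //; rewrite -eq_sh'.
  exact: tableau_shape.
- by apply: perm_trans (perm_rsk_insertl _ _ eq_sh) _; rewrite perm_cons.
apply: perm_trans (perm_rsk_insertr _ _ eq_sh) _.
rewrite -[0 :: _]/(iota 0 (size w).+1) -addn1 iotaD add0n /= cats1.
by rewrite perm_sym perm_rcons perm_cons perm_sym.
Qed.

Lemma rsk_inj w w' : size w = size w' -> rsk w = rsk w' -> w = w'.
Proof.
elim: w w' => [|x w IH] [|x' w'] //= [eq_sz].
have := IH w' eq_sz; have := rskP w; have := rskP w'.
case: (rsk w) (rsk w') => T Q [T' Q'] /=.
move=> [eq_sh' /and3P[T'_gt0 T'_s _] _ _ permQ'] [eq_sh /and3P[T_gt0 T_s _] _ _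
  permQ] IH'.
rewrite -eq_sz => eq_ins.
have lt_sz Q0 : perm_eq (flatten Q0) (iota 0 (size w)) ->
    all (fun z => z < size w) (flatten Q0).
  by move=> /perm_all ->; apply/allP => z; rewrite mem_iota.
rewrite -eq_sz in permQ'.
have [eqT eqQ ->] := rsk_insert_inj eq_sh eq_sh' T_gt0 T'_gt0 T_s T'_s
  (lt_sz _ permQ) (lt_sz _ permQ') eq_ins.
by rewrite IH' // eqT eqQ.
Qed.

End RSK.

(** * Kostka numbers *)

(** The list [L] exhibits the support as finite, so the convention for infinite supports does not
    intervene. *)
Lemma content_gf_size (T : choiceType) (cont : T -> monomial) (A : set T)
    (alpha : monomial) (L : seq T) :
    uniq L -> (forall a, (A a /\ cont a = alpha) <-> a \in L) ->
  content_gf cont A alpha = (size L)%:R.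
Proof.
move=> L_uniq inL; rewrite /content_gf.
rewrite -(@fsbig_widen _ _ _ _ [set` L] A); first 1 last.
- by move=> a /inL[].
- move=> a [Aa notL] /=; case: eqP => // eq_a; case: notL; exact/inL.
rewrite -fsbig_seq // big_seq (eq_bigr (fun=> 1)); last first.
  by move=> a /inL[_ ->]; rewrite eqxx.
by rewrite -big_seq big_const_seq count_predT -Monoid.iteropE -mulr_natr mul1r.
Qed.

Lemma content_gf_eq0 (T : choiceType) (cont : T -> monomial) (A : set T)
    (alpha : monomial) :
  (forall a, A a -> cont a <> alpha) -> content_gf cont A alpha = 0.
Proof.
move=> neq; rewrite (@content_gf_size _ _ _ _ [::]) // => a.
by split=> // -[/neq].
Qed.

(** * The rearrangements of a word as a permutation module *)

Section Rearrangements.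
Variables (n : nat) (s : n.-tuple nat).

Definition rearr := seq_sub (permutations s).
HB.instance Definition _ := Finite.on rearr.

Lemma rearr_perm (x : rearr) : perm_eq (val x) s.
Proof. by rewrite -mem_permutations; exact: (valP x). Qed.

Lemma rearr_size (x : rearr) : size (val x) = n.
Proof. by rewrite (perm_size (rearr_perm x)) size_tuple. Qed.

(** The inverse makes permutation of places a right action. *)
Definition place (w : seq nat) (g : 'S_n) : seq nat :=
  [seq nth 0%N w (g^-1 k)%g | k <- enum 'I_n].

Lemma size_place w g : size (place w g) = n.
Proof. by rewrite size_map size_enum_ord. Qed.

Lemma nth_place w g (k : 'I_n) : nth 0%N (place w g) k = nth 0%N w (g^-1 k)%g.
Proof.
by rewrite (nth_map k) ?size_enum_ord // nth_ord_enum.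
Qed.

Lemma place1 w : size w = n -> place w 1%g = w.
Proof.
move=> sz_w; apply: (@eq_from_nth _ 0%N); rewrite ?size_place // => i lt_i.
by rewrite -[i]/(val (Ordinal lt_i)) nth_place invg1 perm1.
Qed.

Lemma perm_place w g : size w = n -> perm_eq (place w g) w.
Proof.
move=> sz_w; rewrite -{2}(place1 sz_w) /place invg1.
have -> : [seq nth 0%N w ((1%g : 'S_n) k) | k <- enum 'I_n]
          = [seq nth 0%N w (val k) | k <- enum 'I_n].
  by apply: eq_map => k; rewrite perm1.
rewrite (map_comp (fun k : 'I_n => nth 0%N w (val k)) (g^-1)%g); apply: perm_map.
apply: uniq_perm; rewrite ?enum_uniq //.
  by rewrite (map_inj_uniq perm_inj) enum_uniq.
move=> k; rewrite mem_enum inE; apply/mapP; exists (g k); rewrite ?permK //.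
by rewrite mem_enum.
Qed.

Lemma place_mem (x : rearr) g : place (val x) g \in permutations s.
Proof.
by rewrite mem_permutations (perm_trans (perm_place _ (rearr_size x))) ?rearr_perm.
Qed.

Definition rearr_act (x : rearr) (g : 'S_n) : rearr := SeqSub (place_mem x g).

Lemma rearr_act1 : rearr_act^~ 1%g =1 id.
Proof. by move=> x; apply: val_inj; rewrite /= place1 ?rearr_size. Qed.

Lemma rearr_actM (x : rearr) : act_morph rearr_act x.
Proof.
move=> g h; apply: val_inj => /=.
apply: (@eq_from_nth _ 0%N); rewrite ?size_place // => i lt_i.
by rewrite -[i]/(val (Ordinal lt_i)) !nth_place invMg permM.
Qed.

Definition rearr_action : {action 'S_n &-> rearr} :=
  TotalAction rearr_act1 rearr_actM.

Definition rearr_letter (x : rearr) (k : 'I_n) : nat := nth 0%N (val x) k.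

Lemma rearr_letter_act x g k :
  rearr_letter (rearr_action x g) k = rearr_letter x (g^-1 k)%g.
Proof. exact: nth_place. Qed.

Lemma rearr_letter_inj x y : rearr_letter x =1 rearr_letter y -> x = y.
Proof.
move=> eq_xy; apply: val_inj; apply: (@eq_from_nth _ 0%N); rewrite ?rearr_size //.
by move=> i lt_i; exact: (eq_xy (Ordinal lt_i)).
Qed.

Lemma card_rearr (P : pred (seq nat)) :
  #|[pred x : rearr | P (val x)]| = count P (permutations s).
Proof.
rewrite -size_filter cardE -(size_map val) /=; apply: perm_size.
apply: uniq_perm; rewrite ?filter_uniq ?permutations_uniq //.
  by rewrite map_inj_uniq ?enum_uniq //; exact: val_inj.
move=> w; rewrite mem_filter; apply/mapP/andP => [[x]|[Pw w_s]].
  by rewrite mem_enum inE => Px ->; split=> //; exact: (valP x).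
by exists (SeqSub w_s) => //; rewrite mem_enum inE.
Qed.

(** The Kostka number K_(la,s), with a tableau identified with its row reading word. The letter 0 is
    allowed, so that the content 0, ..., n - 1 counts standard tableaux. *)
Definition kostka (la : seq nat) : nat :=
  #|[pred x : rearr | semistd la (rearr_letter x)]|.

Lemma kostka_le la : sumn la = n ->
  (kostka la)%:R <= '[cfRepr (specht n la),
                      cfRepr (action_repr [set: 'S_n]%G rearr_action)].
Proof.
move=> la_n; rewrite cfdot_cyclic_regular ler_nat.
exact: (semistd_le_rank la_n rearr_letter_act rearr_letter_inj).
Qed.

End Rearrangements.

Lemma all_all_flatten (T : Type) (a : pred T) (ss : seq (seq T)) :
  all (all a) ss = all a (flatten ss).
Proof. by elim: ss => //= t ss ->; rewrite all_cat. Qed.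

Section Tableaux.
Local Open Scope nat_scope.
Variables (n : nat) (la : seq nat).
Hypotheses (la_sorted : sorted geq la) (la_sum : sumn la = n).

Lemma semistd_flatten T : shape T = la ->
  (all (sorted leq) T /\ (forall i j, j < nth 0 la i.+1 ->
     nth 0 (nth [::] T i) j < nth 0 (nth [::] T i.+1) j)) <->
  semistd la (fun k : 'I_n => nth 0 (flatten T) k).
Proof.
move=> shT.
have sz_row i : size (nth [::] T i) = nth 0 la i.
  have [lt_i|ge_i] := ltnP i (size T); first by rewrite -shT (nth_map [::]).
  by rewrite !nth_default // -shT size_map.
have nthE k : nth 0 (flatten T) k
    = nth 0 (nth [::] T (reshape_index la k)) (reshape_offset la k).
  by rewrite nth_flatten shT.
have lt_co (k : 'I_n) : reshape_offset la k < nth 0 la (reshape_index la k).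
  by apply: reshape_offsetP; rewrite la_sum.
have cell i j : j < nth 0 la i -> exists k : 'I_n,
    reshape_index la k = i /\ reshape_offset la k = j.
  move=> lt_j; have := flatten_indexP lt_j; rewrite la_sum => lt_f.
  by exists (Ordinal lt_f); rewrite flatten_indexKl // flatten_indexKr.
split=> [[/allP T_s T_c]|/semistdP[ssr ssc]].
  apply/semistdP; split=> k l; rewrite !nthE => e.
    rewrite e => le_c; set r := nth [::] T _.
    have r_s : sorted leq r.
      rewrite /r; have [lt_i|ge_i] := ltnP (reshape_index la l) (size T).
        by apply: T_s; rewrite mem_nth.
      by rewrite nth_default.
    apply: (sorted_leq_nth leq_trans leqnn) => //; rewrite inE sz_row //.
    exact: leq_ltn_trans le_c (lt_co l).
  (* Tableaux compare adjacent rows only; induction on the lower row reaches all pairs, the cells in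
     between existing because the shape is a partition. *)
  rewrite e; have := lt_co l.
  elim: (reshape_index la l) => // i IH lt_c;
    rewrite ltnS leq_eqVlt => /orP[/eqP->|lt_i].
    exact: T_c.
  apply: ltn_trans (T_c i _ lt_c); apply: IH => //.
  exact: leq_trans lt_c (nth_sorted_geq la_sorted (leqnSn i)).
split=> [|i j lt_j].
  apply/allP => r /(nthP [::])[i lt_i <-]; apply/(sortedP 0) => j;
    rewrite sz_row => lt_j.
  have [k [rk ck]] := cell i j (ltnW lt_j); have [l [rl cl]] := cell i j.+1 lt_j.
  by have := ssr k l; rewrite !nthE rk ck rl cl leqnSn; apply.
have [l [rl cl]] := cell i.+1 j lt_j.
have [k [rk ck]] := cell i j (leq_trans lt_j (nth_sorted_geq la_sorted (leqnSn i))).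
by have := ssc k l; rewrite !nthE rk ck rl cl ltnSn; apply.
Qed.

Lemma schur_kostka (s : n.-tuple nat) : all (leq 1) s ->
  schur la (seq_mset s) = (kostka s la)%:R.
Proof.
move=> s_gt0; rewrite /kostka.
rewrite (card_rearr s (fun w => semistd la (fun k : 'I_n => nth 0 w k)))
  -size_filter.
rewrite /schur -(size_map (reshape la)); apply: content_gf_size.
  rewrite map_inj_in_uniq ?filter_uniq ?permutations_uniq // => w w'.
  rewrite !mem_filter !mem_permutations => /andP[_ pw] /andP[_ pw'].
  move/(congr1 flatten); rewrite !reshapeKr // la_sum.
    by rewrite (perm_size pw') size_tuple.
  by rewrite (perm_size pw) size_tuple.
move=> T; split=> [[[shT T_gt0 T_s T_c] contT]|/mapP[w]].
  have perm_T : perm_eq (flatten T) s by exact/eq_seq_msetP.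
  apply/mapP; exists (flatten T); last by rewrite -shT flattenK.
  rewrite mem_filter mem_permutations perm_T andbT.
  exact/(semistd_flatten shT).
rewrite mem_filter mem_permutations => /andP[ssw pw] ->.
have sz_w : size w = sumn la by rewrite (perm_size pw) size_tuple la_sum.
have sh : shape (reshape la w) = la by rewrite reshapeKl ?sz_w.
have fl : flatten (reshape la w) = w by rewrite reshapeKr ?sz_w.
rewrite -{1}fl in ssw; have [T_s T_c] := (semistd_flatten sh).2 ssw.
split; last by rewrite /tcont fl; apply/eq_seq_msetP.
by split=> //; rewrite all_all_flatten fl (perm_all _ pw).
Qed.

End Tableaux.

Section Count.
Local Open Scope nat_scope.
Variables (n : nat) (s : n.-tuple nat).

Lemma parts_size (la : n.-tuple 'I_n.+1) : size (parts la) = n.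
Proof. by rewrite size_map size_tuple. Qed.

Lemma is_partP (la : n.-tuple 'I_n.+1) :
  is_part la -> sorted geq (parts la) /\ sumn (parts la) = n.
Proof. by case/andP => ? /eqP. Qed.

(** Partitions of n carry n parts, zeros included; empty rows bring a tableau to that format. *)
Definition pad (T : seq (seq nat)) : seq (seq nat) := T ++ nseq (n - size T) [::].

Lemma flatten_pad T : flatten (pad T) = flatten T.
Proof.
rewrite flatten_cat; suff -> : flatten (nseq (n - size T) [::]) = [::] :> seq nat.
  by rewrite cats0.
by elim: (n - size T).
Qed.

Definition shape_tuple (T : seq (seq nat)) : n.-tuple 'I_n.+1 :=
  [tuple inord (nth 0 (shape T) i) | i < n].

Lemma tableau_size T : tableau T -> size (flatten T) = n -> size T <= n.
Proof.
case/and3P=> T_gt0 _ _ <-; rewrite size_flatten.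
elim: T T_gt0 => //= r T IH /andP[r_gt0 /IH]; rewrite -add1n; exact: leq_add.
Qed.

Lemma parts_shape T : tableau T -> size (flatten T) = n ->
  parts (shape_tuple T) = shape (pad T).
Proof.
move=> T_tab T_n; have sz_T := tableau_size T_tab T_n.
apply: (@eq_from_nth _ 0).
  by rewrite parts_size size_map size_cat size_nseq subnKC.
rewrite parts_size => i lt_i; rewrite (nth_map ord0) ?size_tuple //.
rewrite -[i]/(val (Ordinal lt_i)) -tnth_nth tnth_mktuple /= inordK.
  rewrite /shape map_cat nth_cat size_map; case: ltnP => // le_i.
  by rewrite nth_default ?size_map // map_nseq nth_nseq if_same.
rewrite ltnS -T_n size_flatten.
have [lt_sz|ge_sz] := ltnP i (size (shape T)); last by rewrite nth_default.
by rewrite sumnE (big_nth 0) big_mkord (bigD1 (Ordinal lt_sz)) //= leq_addr.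
Qed.

Lemma is_part_shape T : tableau T -> size (flatten T) = n ->
  is_part (shape_tuple T).
Proof.
move=> T_tab T_n; rewrite /is_part parts_shape // -size_flatten flatten_pad T_n
  eqxx.
rewrite andbT /shape map_cat map_nseq /=.
have := tableau_shape T_tab; rewrite /shape; move: (map size T) => sh.
elim: sh => [|a [|b sh] IH] /=; first by elim: (n - size T) => [|[|m]].
  by move=> _; case: (n - size T) => //= m; elim: m.
by case/andP=> -> /IH.
Qed.

Lemma semistd_shape T : tableau T -> size (flatten T) = n ->
  semistd (parts (shape_tuple T)) (fun k : 'I_n => nth 0 (flatten T) k).
Proof.
move=> T_tab T_n; have [la_s la_n] := is_partP (is_part_shape T_tab T_n).
rewrite -flatten_pad; apply/(semistd_flatten la_s la_n);
  first by rewrite parts_shape.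
have /and3P[_ T_s T_dom] := T_tab; split.
  by rewrite all_cat T_s; apply/allP => r /nseqP[->].
rewrite parts_shape // => i j.
have [lt_i|ge_i] := ltnP i.+1 (size T); last first.
  rewrite /shape map_cat nth_cat size_map [i.+1 < size T]ltnNge ge_i /= map_nseq.
  by rewrite nth_nseq if_same.
rewrite /shape map_cat nth_cat size_map lt_i (nth_map [::]) // /pad !nth_cat lt_i.
rewrite (ltnW lt_i); move: T_dom => /(sortedP [::]) /(_ i lt_i) /domP[_].
exact.
Qed.

(** An RSK pair is stored as its padded common shape and two reading words. Deleting the zeros of
    the shape allows both tableaux to be rebuilt, so the injectivity of [rsk] carries over. *)
Lemma card_rearr_le : #|{: rearr s}| <=
  \sum_(la : n.-tuple 'I_n.+1 | is_part la)
     kostka s (parts la) * kostka (iota_tuple n 0) (parts la).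
Proof.
pose io := iota_tuple n 0.
have perm1 (x : rearr s) : perm_eq (flatten (rsk (val x)).1) s.
  by have [_ _ _ /perm_trans -> //] := rskP (val x); exact: rearr_perm.
have perm2 (x : rearr s) : perm_eq (flatten (rsk (val x)).2) io.
  by have [_ _ _ _] := rskP (val x); rewrite rearr_size.
have mem1 (x : rearr s) : flatten (rsk (val x)).1 \in permutations s by rewrite
  mem_permutations.
have mem2 (x : rearr s) : flatten (rsk (val x)).2 \in permutations io by
  rewrite mem_permutations.
pose F (x : rearr s) : n.-tuple 'I_n.+1 * (rearr s * rearr io) :=
  (shape_tuple (rsk (val x)).1, (SeqSub (mem1 x), SeqSub (mem2 x))).
have sz1 (x : rearr s) : size (flatten (rsk (val x)).1) = n.
  by rewrite (perm_size (perm1 x)) size_tuple.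
have sz2 (x : rearr s) : size (flatten (rsk (val x)).2) = n.
  by rewrite (perm_size (perm2 x)) size_tuple.
have shapeE (x : rearr s) : shape (rsk (val x)).1
    = [seq a <- parts (shape_tuple (rsk (val x)).1) | 0 < a].
  have [_ T_tab _ _ _] := rskP (val x); rewrite parts_shape //.
  rewrite /shape map_cat filter_cat map_nseq /= filter_nseq /= cats0.
  have /and3P[T_gt0 _ _] := T_tab.
  by apply/esym/all_filterP; rewrite all_map.
have F_inj : injective F.
  move=> x y eqF; have eq_la : shape_tuple _ = shape_tuple _ := congr1 fst eqF.
  have /= eq1 := congr1 (fun z => val z.2.1) eqF.
  have /= eq2 := congr1 (fun z => val z.2.2) eqF.
  have [eq_sx _ _ _ _] := rskP (val x); have [eq_sy _ _ _ _] := rskP (val y).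
  have eq_sh : shape (rsk (val x)).1 = shape (rsk (val y)).1.
    by rewrite !shapeE eq_la.
  apply: val_inj; apply: rsk_inj; first by rewrite !rearr_size.
  rewrite [LHS]surjective_pairing [RHS]surjective_pairing.
  congr (_, _); apply: eq_from_flatten_shape => //.
  by rewrite -eq_sx -eq_sy.
rewrite -(card_imset _ F_inj).
pose R (y : n.-tuple 'I_n.+1 * (rearr s * rearr io)) :=
  [&& is_part y.1, semistd (parts y.1) (rearr_letter y.2.1)
    & semistd (parts y.1) (rearr_letter y.2.2)].
apply: (@leq_trans #|[pred y | R y]|).
  apply/subset_leq_card/fintype.subsetP => y /imsetP[x _ ->]; rewrite inE /R /=.
  have [eq_sh T_tab Q_tab _ _] := rskP (val x).
  have -> : shape_tuple (rsk (val x)).1 = shape_tuple (rsk (val x)).2.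
    by apply: eq_from_tnth => i; rewrite !tnth_mktuple eq_sh.
  rewrite is_part_shape // (semistd_shape Q_tab) // andbT /=.
  have <- : shape_tuple (rsk (val x)).1 = shape_tuple (rsk (val x)).2.
    by apply: eq_from_tnth => i; rewrite !tnth_mktuple eq_sh.
  exact: semistd_shape.
rewrite -sum1_card (eq_bigl (fun y => is_part y.1 &&
    (semistd (parts y.1) (rearr_letter y.2.1)
       && semistd (parts y.1) (rearr_letter y.2.2)))) //.
rewrite -(pair_big_dep (fun la : n.-tuple 'I_n.+1 => is_part la)
  (fun la (xy : rearr s * rearr io) => semistd (parts la) (rearr_letter xy.1)
       && semistd (parts la) (rearr_letter xy.2)) (fun _ _ => 1)) /=.
apply: leq_sum => la _.
rewrite -(pair_big_dep (fun x : rearr s => semistd (parts la) (rearr_letter x))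
  (fun _ (y : rearr io) => semistd (parts la) (rearr_letter y)) (fun _ _ => 1)) /=.
by rewrite sum_nat_const sum1_card /kostka leq_mul //;
  apply/eq_leq/eq_card => x; rewrite !inE.
Qed.

End Count.

(** * Young's rule *)

Section CharDecomposition.
Variables (gT : finGroupType) (G : {group gT}) (I : finType) (P : pred I).
Variables (chi : I -> 'CF(G)) (pi : 'CF(G)) (K f : I -> nat).
Hypothesis pi_char : pi \is a character.
Hypothesis chi_char : forall i, chi i \is a character.
Hypothesis chi_dot : forall i j, P i -> P j -> '[chi i, chi j] <= (i == j)%:R.
Hypothesis K_le : forall i, P i -> (K i)%:R <= '[chi i, pi].
Hypothesis f_le : forall i, P i -> (f i)%:R <= chi i 1%g.
Hypothesis pi_le : pi 1%g <= (\sum_(i | P i) K i * f i)%:R.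

(** The norm of a character is a natural number, here at most 1. *)
Lemma char_irr_or0 i : P i -> chi i = 0 \/ chi i \in irr G.
Proof.
move=> Pi; have /natrP[m def_m] := Cnat_cfdot_char (chi_char i) (chi_char i).
have := chi_dot Pi Pi; rewrite eqxx def_m (ler_nat _ m 1).
case: m def_m => [|[|//]] def_m _; [left|right].
  by apply/eqP; rewrite -cfnorm_eq0 def_m.
by rewrite irrEchar chi_char def_m eqxx.
Qed.

Let m i := '[chi i, pi].
Let theta := pi - \sum_(i | P i) m i *: chi i.

(** The nonzero [chi i] are distinct irreducible characters, and [theta] is [pi] with these
    constituents removed; the other coefficients are multiplicities in [pi]. *)
Lemma theta_char : theta \is a character.
Proof.
rewrite [theta]cfun_sum_cfdot; apply: rpred_sum => j _.
suff /natrP[k ->] : '[theta, 'chi_j] \in Num.nat.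
  by rewrite scaler_nat rpredMn ?irr_char.
rewrite cfdotBl cfdot_suml.
have [[i0 Pi0 eq_i0]|none] := pselect (exists2 i, P i & chi i = 'chi_j).
  rewrite (bigD1 i0) //= big1 => [|i /andP[Pi neq]].
    rewrite addr0 cfdotZl eq_i0 cfnorm_irr mulr1 /m eq_i0.
    by rewrite cfdotC_char ?irr_char // subrr.
  have := chi_dot Pi Pi0; rewrite (negPf neq) -eq_i0 cfdotZl => le0.
  suff -> : '[chi i, chi i0] = 0 by rewrite mulr0.
  by apply/le_anti; rewrite le0 natr_ge0 // Cnat_cfdot_char.
rewrite big1 ?subr0 ?Cnat_cfdot_char ?irr_char // => i Pi.
rewrite cfdotZl; have [->|/irrP[k def_k]] := char_irr_or0 Pi.
  by rewrite cfdot0l mulr0.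
rewrite def_k cfdot_irr; case: eqP => [eq_k|]; last by rewrite mulr0.
by case: none; exists i; rewrite // def_k eq_k.
Qed.

(** Squeeze: pi(1) <= sum K f <= sum m chi(1) <= pi(1), the last step because [theta] is a
    character. Equality makes [theta] vanish and each m chi(1) equal to K f <= K chi(1), whence m =
    K wherever [chi i] is nonzero. *)
Lemma char_decomposition : pi = \sum_(i | P i) (K i)%:R *: chi i.
Proof.
have chi1_ge0 i : 0 <= chi i 1%g by exact: char1_ge0.
have le_i i : P i -> (K i * f i)%:R <= m i * chi i 1%g.
  move=> Pi; rewrite natrM; apply: ler_pM; rewrite ?ler0n //.
    exact: K_le.
  exact: f_le.
have sum0 : \sum_(i | P i) (m i * chi i 1%g - (K i * f i)%:R) + theta 1%g = 0.
  apply/le_anti; rewrite addr_ge0 ?char1_ge0 ?theta_char ?sumr_ge0 ?andbT //;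
    last first.
    by move=> i Pi; rewrite subr_ge0 le_i.
  rewrite sumrB -natr_sum /theta !cfunE sum_cfunE.
  under [X in _ + (_ - X)]eq_bigr do rewrite cfunE.
  by rewrite addrAC addrCA subrr addr0 subr_le0.
move/eqP: sum0; rewrite paddr_eq0 ?char1_ge0 ?theta_char ?sumr_ge0 //; last first.
  by move=> i Pi; rewrite subr_ge0 le_i.
case/andP=> /eqP sum0; rewrite char1_eq0 ?theta_char // subr_eq0 => /eqP ->.
apply: eq_bigr => i Pi.
have eq_i : m i * chi i 1%g = (K i * f i)%:R.
  apply/eqP; rewrite -subr_eq0.
  have /eqP := sum0; rewrite psumr_eq0 => [/allP/(_ i)|j Pj];
    last by rewrite subr_ge0 le_i.
  by rewrite mem_index_enum Pi => /(_ isT).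
have [->|chi_neq0] := eqVneq (chi i) 0; first by rewrite !scaler0.
have chi1_gt0 : 0 < chi i 1%g by rewrite lt_def chi1_ge0 char1_eq0 // chi_neq0.
suff /eqP -> : m i == (K i)%:R by [].
rewrite eq_le K_le // andbT -(ler_pM2r chi1_gt0) eq_i natrM.
by apply: ler_wpM2l (f_le Pi); rewrite ler0n.
Qed.

End CharDecomposition.

(** Only the identity fixes a word with distinct letters, so this permutation character is the
    regular one. *)
Lemma rearr_iota_regular n (rho : 'CF([set: 'S_n])) :
  '[rho, cfRepr (action_repr [set: 'S_n]%G (rearr_action (iota_tuple n 0)))]
    = rho 1%g.
Proof.
rewrite cfdotE (bigD1 1%g) ?inE //= big1 => [|g /andP[_ g1]].
  rewrite addr0 cfRepr_action ?inE //.
  have -> : [set x | rearr_action (iota_tuple n 0) x 1%g == x]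
      = [set: rearr (iota_tuple n 0)] by apply/setP => x; rewrite !inE act1 eqxx.
  have -> : #|[set: rearr (iota_tuple n 0)]| = n`!.
    rewrite cardsT; transitivity #|[pred x : rearr (iota_tuple n 0) | xpredT
      (val x)]|.
      exact: eq_card.
    by rewrite (card_rearr _ xpredT) count_predT size_permutations ?iota_uniq
      ?size_iota.
  rewrite [#|[set: 'S_n]%G|]cardsT card_Sn conjC_nat.
  by rewrite mulrCA mulVf ?mulr1 // pnatr_eq0 -lt0n fact_gt0.
rewrite cfRepr_action ?inE //.
have -> : [set x | rearr_action (iota_tuple n 0) x g == x] = finset.set0.
  apply/setP => x; rewrite !inE; apply/negbTE; apply: contra g1 => /eqP fix_x.
  apply/eqP/permP => k; rewrite perm1; apply/eqP; rewrite -(inj_eq val_inj) /=.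
  have x_uniq : uniq (val x) by rewrite (perm_uniq (rearr_perm x)) iota_uniq.
  rewrite -(nth_uniq 0%N _ _ x_uniq) ?rearr_size //.
  have := rearr_letter_act x g (g k); rewrite fix_x permK => eq_k.
  by apply/eqP.
by rewrite cards0 conjC0 mulr0.
Qed.

Lemma young_rule n (s : n.-tuple nat) :
  cfRepr (action_repr [set: 'S_n]%G (rearr_action s)) =
  \sum_(la : n.-tuple 'I_n.+1 | is_part la)
    (kostka s (parts la))%:R *: cfRepr (specht n (parts la)).
Proof.
apply: (@char_decomposition _ _ _ _ (fun la => cfRepr (specht n (parts la))) _
  (fun la => kostka s (parts la)) (fun la => kostka (iota_tuple n 0) (parts la))).
- exact: cfRepr_char.
- by move=> la; exact: cfRepr_char.
- move=> la mu /is_partP[la_s la_n] /is_partP[mu_s mu_n].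
  rewrite eq_sym; have <- : (parts mu == parts la) = (mu == la).
    by apply: (inj_eq (_ : injective (@parts n))) => x y /(inj_map val_inj)/val_inj.
  by apply: specht_orthonormal => //; rewrite !parts_size.
- by move=> la /is_partP[_ la_n]; exact: kostka_le.
- by move=> la /is_partP[_ la_n]; rewrite -rearr_iota_regular; exact: kostka_le.
rewrite cfRepr1 ler_nat; exact: card_rearr_le.
Qed.

Lemma Ch_rearr n (s : n.-tuple nat) (phi : 'CF([set: 'S_n])) : all (leq 1) s ->
  Ch phi (seq_mset s)
    = '[phi, cfRepr (action_repr [set: 'S_n]%G (rearr_action s))].
Proof.
move=> s_gt0; rewrite young_rule cfdot_sumr;
  apply: eq_bigr => la /is_partP[la_s la_n].
by rewrite (schur_kostka la_s la_n s_gt0) cfdotZr conjC_nat mulrC.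
Qed.

Lemma Ch_eq0 n (phi : 'CF([set: 'S_n])) alpha :
    (forall w, words n w -> wcont w <> alpha) ->
  Ch phi alpha = 0.
Proof.
move=> none; apply: big1 => la /is_partP[la_s la_n].
rewrite [schur _ _]content_gf_eq0 ?mulr0 // => T [shT T_gt0 _ _].
apply: none; split; last by rewrite -all_all_flatten.
by rewrite size_flatten shT.
Qed.

(** * Periods and rotations of words *)

Section WordPowers.
Local Open Scope nat_scope.
Implicit Types (u v w : seq nat).

Lemma wpowD v a b : wpow v (a + b) = wpow v a ++ wpow v b.
Proof. by rewrite /wpow nseqD flatten_cat. Qed.

Lemma wpow1 v : wpow v 1 = v.
Proof. exact: cats0. Qed.

Lemma wpowS v a : wpow v a.+1 = v ++ wpow v a.
Proof. by []. Qed.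

Lemma wpowM v a b : wpow v (a * b) = wpow (wpow v a) b.
Proof. by elim: b => [|b IH]; rewrite ?muln0 // mulnS wpowD IH. Qed.

Lemma size_wpow v a : size (wpow v a) = a * size v.
Proof. by elim: a => // a IH; rewrite wpowS size_cat IH. Qed.

Lemma wpow_comm v a : v ++ wpow v a = wpow v a ++ v.
Proof. by rewrite -wpowS -addn1 wpowD wpow1. Qed.

Lemma rot_wpow v a : rot (size v) (wpow v a) = wpow v a.
Proof. by case: a => [|a]; [exact: rot_oversize | rewrite wpowS rot_size_cat
  wpow_comm]. Qed.

(** If [v] is longer than [u], commuting makes [u] a prefix of [v]; it is removed and the induction
    continues. *)
Lemma comm_wpow u v a : u ++ v = v ++ u -> size v = a * size u -> v = wpow u a.
Proof.
elim: a v => [|a IH] v comm; first by move/size0nil.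
rewrite mulSn => sz_v.
have : take (size u) (u ++ v) = take (size u) (v ++ u) by rewrite comm.
rewrite take_size_cat // take_cat; case: ltnP => [_|le_v].
  move=> def_u; move: comm sz_v; rewrite -[v](cat_take_drop (size u)) -def_u.
  rewrite -catA => /eqP; rewrite eqseq_cat // eqxx /= => /eqP comm.
  rewrite size_cat => /addnI sz; rewrite wpowS; congr (_ ++ _).
  exact: IH.
have eq_sz : size v = size u by lia.
move=> _; move/eqP: comm; rewrite eqseq_cat // => /andP[/eqP -> _].
rewrite wpowS; have : a * size v = 0 by lia.
case: a {IH sz_v} => [|a]; first by rewrite cats0.
by move/eqP; rewrite muln_eq0 /= => /nilP ->; elim: a.
Qed.

Lemma take_wpow v a b : a <= b -> take (a * size v) (wpow v b) = wpow v a.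
Proof. by move=> le_ab; rewrite -(subnKC le_ab) wpowD take_size_cat ?size_wpow. Qed.

End WordPowers.

Section Rotations.
Local Open Scope nat_scope.
Implicit Types (u v w : seq nat).

Lemma rot_iter i w : i <= size w -> rot i w = iter i (rot 1) w.
Proof.
elim: i => [|i IH] lt_i; first by rewrite rot0.
by rewrite (rotS lt_i) IH // ltnW.
Qed.

Lemma iter_rot_size w : iter (size w) (rot 1) w = w.
Proof. by rewrite -rot_iter // rot_size. Qed.

Lemma iter_rot_inj i : injective (iter i (rot 1) : seq nat -> seq nat).
Proof. by elim: i => // i IH u v /rot_inj/IH. Qed.

(** Iterates of [rot 1] are used because [rot i] is the identity beyond the length of the word, so
    that its exponents do not add up. *)
Definition period w : nat :=
  (find (fun i => iter i.+1 (rot 1) w == w) (iota 0 (size w))).+1.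

Lemma period_gt0 w : 0 < period w. Proof. by []. Qed.

Lemma iter_rot_period w : 0 < size w -> iter (period w) (rot 1) w = w.
Proof.
move=> w_gt0; set P := fun i => iter i.+1 (rot 1) w == w.
have hasP : has P (iota 0 (size w)).
  apply/hasP; exists (size w).-1; first by rewrite mem_iota add0n ltn_predL.
  by rewrite /P prednK // iter_rot_size.
have := nth_find 0 hasP; rewrite nth_iota ?add0n => [/eqP //|].
by rewrite -[ltnRHS](size_iota 0) -has_find.
Qed.

Lemma period_min w k : 0 < k -> iter k (rot 1) w = w -> period w <= k.
Proof.
case: k => // k _ k_w; rewrite ltnS leqNgt; apply/negP => lt_k.
have := before_find 0 lt_k; rewrite nth_iota ?add0n ?k_w ?eqxx //.
by rewrite -[ltnRHS](size_iota 0); apply: leq_trans lt_k (find_size _ _).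
Qed.

Section Period.
Variable w : seq nat.
Hypothesis w_gt0 : 0 < size w.
Local Notation p := (period w).

Lemma iter_rot_dvd k : (iter k (rot 1) w == w) = (p %| k).
Proof.
have mulp a : iter (a * p) (rot 1) w = w.
  by elim: a => // a IH; rewrite mulSn iterD IH iter_rot_period.
apply/eqP/idP => [|/dvdnP[a ->]]; last exact: mulp.
rewrite {1}(divn_eq k p) addnC iterD mulp => r_w.
rewrite /dvdn -leqn0 leqNgt; apply/negP => r_gt0.
by have := period_min r_gt0 r_w; rewrite leqNgt ltn_pmod.
Qed.

Lemma period_dvd : p %| size w.
Proof. by rewrite -iter_rot_dvd iter_rot_size. Qed.

Lemma rot_dvd k : k <= size w -> (rot k w == w) = (p %| k).
Proof. by move=> le_k; rewrite rot_iter // iter_rot_dvd. Qed.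

Lemma iter_rot_eq i j : (iter i (rot 1) w == iter j (rot 1) w) = (i == j %[mod p]).
Proof.
wlog le_ij : i j / i <= j => [IH|].
  by have [|/ltnW] := leqP i j => /IH //; rewrite eq_sym [in RHS]eq_sym.
rewrite -{1}(subnKC le_ij) iterD (inj_eq (iter_rot_inj (i:=i))) eq_sym.
by rewrite iter_rot_dvd [in RHS]eq_sym eqn_mod_dvd.
Qed.

Lemma wpow_period : w = wpow (take p w) (size w %/ p).
Proof.
have le_p : p <= size w by apply: dvdn_leq => //; exact: period_dvd.
have sz_t : size (take p w) = p by rewrite size_takel.
have [m def_n] := dvdnP period_dvd.
have m_gt0 : 0 < m by move: w_gt0; rewrite def_n; case: (m).
rewrite def_n mulnK //; case: m m_gt0 def_n => // m _ def_n.
rewrite wpowS -{1}(cat_take_drop p w); congr (_ ++ _).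
apply: comm_wpow; last by rewrite sz_t size_drop def_n mulSn addKn.
have /eqP := rot_dvd le_p; rewrite dvdnn; move/eqP.
by rewrite cat_take_drop /rot => /eqP.
Qed.

(** The prefix of length [period w] is primitive: were it a proper power, a shorter rotation would
    fix [w]. Any primitive root of [w] is a power of this prefix, hence equal to it. *)
Lemma freq_period : freq w = size w %/ p.
Proof.
have le_p : p <= size w by apply: dvdn_leq => //; exact: period_dvd.
have sz_t : size (take p w) = p by rewrite size_takel.
have prim v k : 1 < k -> wpow v k = take p w -> False.
  move=> k_gt1 eq_v; have sz_v : k * size v = p by rewrite -size_wpow eq_v.
  have v_gt0 : 0 < size v by case: (size v) sz_v; rewrite ?muln0.
  have : p %| size v.
    rewrite -rot_dvd; last by rewrite (leq_trans _ le_p) // -sz_v leq_pmull // ltnW.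
    by rewrite wpow_period -eq_v -wpowM rot_wpow.
  move/(dvdn_leq v_gt0); rewrite -sz_v leqNgt => /negP; apply.
  by rewrite -[ltnLHS]mul1n ltn_pmul2r.
apply: xget_unique => [|f [v v_prim def_w]].
  exists (take p w); last exact: wpow_period.
  by case=> v [k k_gt1 eq_v]; exact: prim k_gt1 (esym eq_v).
have f_gt0 : 0 < f by move: w_gt0; rewrite def_w size_wpow; case: (f).
have v_gt0 : 0 < size v by move: w_gt0; rewrite def_w size_wpow;
  case: (size v); rewrite ?muln0.
have le_v : size v <= size w by rewrite def_w size_wpow leq_pmull.
have /dvdnP[k sz_v] : p %| size v by rewrite -rot_dvd // def_w rot_wpow.
have le_k : k <= size w %/ p by rewrite -(leq_pmul2r (period_gt0 w)) divnK
  ?period_dvd // -sz_v.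
have def_v : v = wpow (take p w) k.
  rewrite -(take_wpow _ le_k) sz_t -wpow_period -sz_v [in RHS]def_w.
  by rewrite -(prednK f_gt0) wpowS take_size_cat.
have k1 : k = 1.
  case: k sz_v def_v {le_k} => [|[|k]] // sz_v def_v;
    first by rewrite sz_v in v_gt0.
  by case: v_prim; exists (take p w), k.+2.
by rewrite {1}def_w size_wpow sz_v k1 mul1n mulnK.
Qed.

Lemma freq_gt0 : 0 < freq w.
Proof. by rewrite freq_period divn_gt0 // dvdn_leq ?period_dvd. Qed.

Lemma period_freq : p * freq w = size w.
Proof. by rewrite freq_period mulnC divnK // period_dvd. Qed.

Definition rotations := undup [seq rot i w | i <- iota 0 (size w)].

Lemma rotationsP u : reflect (exists i, u = rot i w) (u \in rotations).
Proof.
rewrite mem_undup; apply: (iffP mapP) => [[i _ ->]|[i ->]]; first by exists i.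
have [lt_i|ge_i] := ltnP i (size w); first by exists i; rewrite // mem_iota.
by exists 0; rewrite ?mem_iota // rot0 rot_oversize.
Qed.

Lemma size_rotations : size rotations = p.
Proof.
have le_p : p <= size w by apply: dvdn_leq => //; exact: period_dvd.
rewrite -[RHS](size_iota 0) -(size_map (rot^~ w)); apply: perm_size.
apply: uniq_perm; rewrite ?undup_uniq //.
  rewrite map_inj_in_uniq ?iota_uniq // => i j;
    rewrite !mem_iota !add0n /= => lt_i lt_j.
  rewrite !rot_iter ?(leq_trans (ltnW _) le_p) // => /eqP.
  by rewrite iter_rot_eq !modn_small // => /eqP.
move=> u; rewrite mem_undup; apply/mapP/mapP => [[i]|[i]].
  rewrite mem_iota add0n => /andP[_ lt_i] ->.
  have lt_r : i %% p < p by rewrite ltn_pmod.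
  exists (i %% p); first by rewrite mem_iota.
  rewrite !rot_iter ?(ltnW lt_i) ?(leq_trans (ltnW lt_r) le_p) //.
  by apply/eqP; rewrite iter_rot_eq modn_mod.
rewrite mem_iota add0n => /andP[_ lt_i] ->; exists i; rewrite ?mem_iota //.
exact: leq_trans lt_i le_p.
Qed.

End Period.

Lemma rotations_self w : 0 < size w -> w \in rotations w.
Proof. by move=> w_gt0; apply/rotationsP => //; exists 0; rewrite rot0. Qed.

Lemma rotations_size w u : 0 < size w -> u \in rotations w -> size u = size w.
Proof. by move=> w_gt0 /(rotationsP w_gt0)[i ->]; rewrite size_rot. Qed.

Lemma rotations_sub w u v : 0 < size w -> u \in rotations w ->
  v \in rotations u -> v \in rotations w.
Proof.
move=> w_gt0 u_w; have u_gt0 : 0 < size u by rewrite (rotations_size w_gt0 u_w).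
case/(rotationsP u_gt0) => i ->; case/(rotationsP w_gt0): u_w => j ->.
apply/(rotationsP w_gt0); have [le_i|/ltnW ge_i] := leqP i (size w); last first.
  by exists j; rewrite rot_oversize // size_rot.
have [le_j|/ltnW ge_j] := leqP j (size w); last first.
  by exists i; rewrite [rot j w]rot_oversize.
by rewrite rot_add_mod //; eexists.
Qed.

Lemma rotations_sym w u : 0 < size w -> u \in rotations w -> w \in rotations u.
Proof.
move=> w_gt0 u_w; have := rotations_size w_gt0 u_w => sz_u.
have u_gt0 : 0 < size u by rewrite sz_u.
case/(rotationsP w_gt0): u_w => i def_u; apply/(rotationsP u_gt0).
by exists (size u - i); rewrite def_u -[rot (_ - _) _]/(rotr i (rot i w)) rotK.
Qed.

Lemma perm_rotations w u : 0 < size w -> u \in rotations w ->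
  perm_eq (rotations u) (rotations w).
Proof.
move=> w_gt0 u_w; have u_gt0 : 0 < size u by rewrite (rotations_size w_gt0 u_w).
apply: uniq_perm; rewrite ?undup_uniq // => v; apply/idP/idP.
  exact: rotations_sub.
exact/rotations_sub/rotations_sym.
Qed.

Lemma period_rotations w u : 0 < size w -> u \in rotations w -> period u = period w.
Proof.
move=> w_gt0 u_w; have u_gt0 : 0 < size u by rewrite (rotations_size w_gt0 u_w).
by rewrite -!size_rotations // (perm_size (perm_rotations w_gt0 u_w)).
Qed.

Lemma freq_rotations w u : 0 < size w -> u \in rotations w -> freq u = freq w.
Proof.
move=> w_gt0 u_w; have u_gt0 : 0 < size u by rewrite (rotations_size w_gt0 u_w).
by rewrite !freq_period // (period_rotations w_gt0 u_w) (rotations_size w_gt0 u_w).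
Qed.

Definition lex_rotations w :=
  sort (fun u v : seqlexi nat => (u <= v)%O) (rotations w).

Lemma lexE w : lex w = (index w (lex_rotations w)).+1.
Proof. by []. Qed.

Lemma lex_rotationsE w u : 0 < size w -> u \in rotations w ->
  lex_rotations u = lex_rotations w.
Proof.
move=> w_gt0 u_w; apply/perm_sortP; last exact: perm_rotations.
- exact: le_total.
- exact: le_trans.
- exact: le_anti.
Qed.

Lemma flex_inj w u v : 0 < size w -> u \in rotations w -> v \in rotations w ->
  flex u = flex v -> u = v.
Proof.
move=> w_gt0 u_w v_w; rewrite /flex !lexE !(freq_rotations w_gt0) //.
rewrite !(lex_rotationsE w_gt0) // => /eqP.
rewrite eqn_pmul2l ?freq_gt0 // eqSS => /eqP eq_i.
rewrite -(nth_index [::] (_ : u \in lex_rotations w)) ?mem_sort // eq_i.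
by rewrite nth_index // mem_sort.
Qed.

(** On a rotation class [lex] takes each value from 1 to the period, and period times frequency is
    the length. *)
Lemma flex_exists w r : 0 < size w -> 0 < r <= size w -> freq w %| r ->
  exists2 u, u \in rotations w & flex u = r.
Proof.
move=> w_gt0 /andP[r_gt0 le_r] /dvdnP[l def_r].
have l_gt0 : 0 < l by move: r_gt0; rewrite def_r; case: (l).
have le_l : l <= period w.
  rewrite -(leq_pmul2r (freq_gt0 w_gt0)) -def_r.
  by rewrite period_freq.
have lt_l : l.-1 < size (lex_rotations w).
  by rewrite size_sort size_rotations // prednK.
pose u := nth [::] (lex_rotations w) l.-1.
have u_w : u \in rotations w by rewrite -(mem_sort (fun u v : seqlexi nat => (u
  <= v)%O)) mem_nth.
exists u => //; rewrite /flex lexE (freq_rotations w_gt0 u_w) (lex_rotationsE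
  w_gt0 u_w).
rewrite index_uniq ?sort_uniq ?undup_uniq // prednK // mulnC.
by rewrite def_r.
Qed.

Lemma freq_dvd_flex w : freq w %| flex w.
Proof. exact: dvdn_mulr. Qed.

End Rotations.

(** * Counting necklaces by characters of the cyclic group *)

Lemma sum_root_unity (F : fieldType) (n : nat) (z : F) : z ^+ n = 1 ->
  \sum_(k < n) z ^+ k = if z == 1 then n%:R else 0.
Proof.
move=> zn; case: eqP => [->|/eqP z1].
  by under eq_bigr do rewrite expr1n; rewrite sumr_const card_ord.
apply: (mulfI (_ : z - 1 != 0)); first by rewrite subr_eq0.
by rewrite mulr0 -subrX1 zn subrr.
Qed.

Lemma sum_dvd_root_unity (F : fieldType) (n p f : nat) (omega : F) r :
    n.-primitive_root omega -> (p * f)%N = n ->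
  \sum_(k < n | (p %| k)%N) omega ^+ (r * k) = if (f %| r)%N then f%:R else 0.
Proof.
move=> prim def_n; have n_gt0 := prim_order_gt0 prim.
have p_gt0 : (0 < p)%N by case: p def_n => // def_n; rewrite -def_n in n_gt0.
have lt_h (j : 'I_f) : (p * j < n)%N by rewrite -def_n ltn_pmul2l.
have lt_h' (k : 'I_n) : (p %| k -> k %/ p < f)%N.
  by move=> _; rewrite ltn_divLR // mulnC def_n.
have f_gt0 : (0 < f)%N by case: f def_n {lt_h lt_h'} => //;
  rewrite muln0 => def_n; rewrite -def_n in n_gt0.
(* Reduction modulo f only makes the inverse map k / p total; it changes nothing for k < n. *)
rewrite (reindex_onto (fun j : 'I_f => Ordinal (lt_h j))
  (fun k : 'I_n => Ordinal (ltn_pmod (k %/ p) f_gt0))); last first.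
  move=> k pk; apply: val_inj; rewrite /= modn_small ?lt_h' //.
  by rewrite mulnC divnK.
rewrite (eq_bigl xpredT) => [|j]; last first.
  rewrite dvdn_mulr //=; apply/eqP; apply: val_inj.
  by rewrite /= mulKn // modn_small.
under eq_bigr do rewrite /= mulnA exprM.
rewrite sum_root_unity; last first.
  by rewrite -exprM -mulnA def_n mulnC exprM (prim_expr_order prim) expr1n.
congr (if _ then _ else _).
rewrite -(expr0 omega) (eq_prim_root_expr prim) mod0n -[(_ %% _ == 0)%N]/(n %| _)%N.
by rewrite -def_n mulnC dvdn_pmul2r.
Qed.

Section Fourier.
Variables (n : nat) (s : n.-tuple nat) (omega : algC).
Hypothesis prim : n.-primitive_root omega.
Local Notation perms := (permutations s).

Definition fix_count k : nat := count (fun w => rot k w == w) perms.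

Let n_gt0 : (0 < n)%N. Proof. exact: prim_order_gt0 prim. Qed.

Lemma perms_size w : w \in perms -> size w = n.
Proof. by rewrite mem_permutations => /perm_size ->; rewrite size_tuple. Qed.

Lemma perms_gt0 w : w \in perms -> (0 < size w)%N.
Proof. by move/perms_size ->. Qed.

Lemma perms_rot w u : w \in perms -> u \in rotations w -> u \in perms.
Proof.
move=> w_s; have w_gt0 := perms_gt0 w_s.
case/(rotationsP w_gt0) => i ->; rewrite !mem_permutations in w_s *.
by rewrite perm_rot.
Qed.

(** After exchanging the sums, each word contributes the powers of omega at the multiples of its
    period. *)
Lemma sum_fix_count r :
  \sum_(k < n) omega ^+ (r * k) * (fix_count k)%:R =
    (\sum_(w <- perms) (freq w %| r) * freq w)%N%:R.
Proof.
have fixE (k : 'I_n) : (fix_count k)%:R = \sum_(w <- perms) (rot k w == w)%:R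
  :> algC.
  by rewrite /fix_count -sum1_count natr_sum big_mkcond; apply: eq_bigr => w _;
    case: eqP.
rewrite (eq_bigr (fun k : 'I_n => \sum_(w <- perms)
    omega ^+ (r * k) * (rot k w == w)%:R)); last first.
  by move=> k _; rewrite -mulr_sumr -fixE.
rewrite exchange_big natr_sum /= big_seq [RHS]big_seq.
apply: eq_bigr => w w_s; have w_gt0 := perms_gt0 w_s.
transitivity (\sum_(k < n | (period w %| k)%N) omega ^+ (r * k)).
  rewrite [RHS]big_mkcond; apply: eq_bigr => k _.
  have -> : (rot k w == w) = (period w %| k)%N.
    by apply: rot_dvd w_gt0 _ _; rewrite (perms_size w_s) ltnW.
  by case: (period w %| k)%N; rewrite ?mulr1 ?mulr0.
have pf : (period w * freq w = n)%N by rewrite period_freq // perms_size.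
rewrite (sum_dvd_root_unity r prim pf).
by case: (freq w %| r)%N; rewrite ?mul1n ?mul0n.
Qed.

(** Double counting of pairs of a word [w] and a rotation [u] of it with flex r, weighted by
    frequency: if the frequency of [w] divides r there is exactly one [u], otherwise none; and each
    [u] comes from [period u] words. *)
Lemma sum_freq_dvd r : (0 < r <= n)%N ->
  (\sum_(w <- perms) (freq w %| r) * freq w)%N
    = (n * count (fun w => flex w == r) perms)%N.
Proof.
move=> r_bd; pose Fl := [seq w <- perms | flex w == r].
have Fl_uniq : uniq Fl by rewrite filter_uniq ?permutations_uniq.
have inFl u : (u \in Fl) = (flex u == r) && (u \in perms) by rewrite mem_filter.
transitivity (\sum_(w <- perms) \sum_(u <- Fl | u \in rotations w) freq u)%N.
  rewrite big_seq [RHS]big_seq; apply: eq_bigr => w w_s.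
  have w_gt0 := perms_gt0 w_s.
  have [fr|nfr] := boolP (freq w %| r)%N; last first.
    rewrite mul0n big_seq_cond big1 // => u /andP[];
      rewrite inFl => /andP[/eqP fl_u _] u_w.
    by case/negP: nfr; rewrite -fl_u -(freq_rotations w_gt0 u_w) freq_dvd_flex.
  have [|u u_w fl_u] := @flex_exists w r w_gt0 _ fr;
    first by rewrite (perms_size w_s).
  have u_Fl : u \in Fl by rewrite inFl fl_u eqxx (perms_rot w_s).
  rewrite big_mkcond (bigD1_seq u) //= u_w big_seq_cond big1 => [|v /andP[]].
    by rewrite addn0 mul1n (freq_rotations w_gt0 u_w).
  rewrite inFl => /andP[/eqP fl_v _] /eqP neq; case: ifP => // v_w; case: neq.
  by apply: (flex_inj w_gt0 v_w u_w); rewrite fl_u.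
rewrite (exchange_big_dep xpredT) //= -size_filter -/Fl.
rewrite -sum1_size big_distrr /= big_seq [RHS]big_seq.
apply: eq_bigr => u; rewrite inFl => /andP[_ u_s]; have u_gt0 := perms_gt0 u_s.
have pf : (period u * freq u = n)%N by rewrite period_freq // perms_size.
rewrite big_const_seq iter_addn_0 muln1 mulnC -[RHS]pf.
congr (_ * _)%N; rewrite -size_rotations // -size_filter; apply: perm_size.
apply: uniq_perm; rewrite ?filter_uniq ?permutations_uniq ?undup_uniq // => w.
rewrite mem_filter; apply/andP/idP => [[u_w w_s]|w_u].
  exact: rotations_sym (perms_gt0 w_s) u_w.
by split; [exact: rotations_sym | exact: perms_rot u_s w_u].
Qed.

Lemma sum_fix_count_flex r : (0 < r <= n)%N ->
  \sum_(k < n) omega ^+ (r * k) * (fix_count k)%:R =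
    n%:R * (count (fun w => flex w == r) perms)%:R.
Proof. by move=> r_bd; rewrite sum_fix_count sum_freq_dvd // natrM. Qed.

Hypothesis s_gt0 : all (leq 1) s.

Lemma perms_words w : (w \in perms) <-> (words n w /\ wcont w = seq_mset s).
Proof.
rewrite mem_permutations; split=> [w_s|[_ /eq_seq_msetP //]].
split; last exact/eq_seq_msetP.
by split; [rewrite (perm_size w_s) size_tuple | rewrite (perm_all _ w_s)].
Qed.

Lemma Flex_count r :
  content_gf wcont (Flex n r) (seq_mset s)
    = (count (fun w => flex w == r) perms)%:R.
Proof.
rewrite -size_filter; apply: content_gf_size.
  by rewrite filter_uniq ?permutations_uniq.
move=> w; rewrite mem_filter; split=> [[[w_n fl_w] w_s]|/andP[/eqP fl_w
  /perms_words[]]//].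
by rewrite fl_w eqxx; apply/perms_words.
Qed.

Lemma necklaceE w : (0 < size w)%N -> necklace w = [set` rotations w]%classic.
Proof.
move=> w_gt0; apply/seteqP; split=> u /=.
  by case=> i _ <-; apply/(rotationsP w_gt0); exists i.
by case/(rotationsP w_gt0) => i ->; exists i.
Qed.

Lemma necklace_repr w : (0 < size w)%N -> xget [::] (necklace w) \in rotations w.
Proof.
move=> w_gt0; have : necklace w (xget [::] (necklace w)).
  by apply: xgetI; exists 0%N => //; exact: rot0.
by rewrite necklaceE.
Qed.

Lemma NFD_count r : (0 < r <= n)%N ->
  content_gf ncont (NFD n r) (seq_mset s)
    = (count (fun w => flex w == r) perms)%:R.
Proof.
move=> r_bd; rewrite -size_filter -(size_map necklace); apply: content_gf_size.
  rewrite map_inj_in_uniq ?filter_uniq ?permutations_uniq // => u v.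
  rewrite !mem_filter => /andP[/eqP fl_u u_s] /andP[/eqP fl_v v_s] eq_neck.
  have u_gt0 := perms_gt0 u_s; have v_gt0 := perms_gt0 v_s.
  apply: (flex_inj u_gt0); rewrite ?rotations_self ?fl_u //.
  have : necklace u v by rewrite eq_neck necklaceE //; exact: rotations_self.
  by rewrite necklaceE.
move=> N; split=> [[[[w [w_n w_pos] <-{N}] fr] cont_w]|/mapP[u]].
  have w_gt0 : (0 < size w)%N by rewrite w_n.
  have u_w := necklace_repr w_gt0; set u := xget _ _ in u_w.
  rewrite /nfreq -/u (freq_rotations w_gt0 u_w) in fr.
  have [|v v_w fl_v] := @flex_exists w r w_gt0 _ fr; first by rewrite w_n.
  apply/mapP; exists v.
    rewrite mem_filter fl_v eqxx /=; apply: (@perms_rot u).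
      rewrite mem_permutations; exact/eq_seq_msetP.
    by apply: rotations_sub v_w;
      rewrite ?(rotations_sym w_gt0) ?(rotations_size w_gt0 u_w).
  have v_gt0 : (0 < size v)%N by rewrite (rotations_size w_gt0 v_w).
  rewrite !necklaceE //; apply/seteqP; split=> x /=;
    by rewrite (perm_mem (perm_rotations w_gt0 v_w)).
rewrite mem_filter => /andP[/eqP fl_u u_s] ->.
have u_gt0 := perms_gt0 u_s; have v_u := necklace_repr u_gt0.
split; last first.
  have /perms_words[_] := perms_rot u_s v_u; exact.
split; first by exists u => //; case/perms_words: u_s.
by rewrite /nfreq (freq_rotations u_gt0 v_u) -fl_u freq_dvd_flex.
Qed.

Lemma fix_action k : (k < n)%N ->
  #|[set x : rearr s | rearr_action s x (sigma n ^+ k)%g == x]| = fix_count k.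
Proof.
move=> lt_k; rewrite /fix_count -(card_rearr s (fun w => rot k w == w)).
rewrite cardsE; apply: eq_card => x.
suff : (rearr_action s x (sigma n ^+ k)%g == x) = (rot k (val x) == val x).
  by rewrite !inE.
(* A permutation and its inverse have the same fixed points; the inverse cancels the one in [place],
   so that letters are read at i + k as by [rot k]. *)
have -> : (rearr_action s x (sigma n ^+ k)%g == x)
        = (rearr_action s x ((sigma n ^+ k)^-1)%g == x).
  apply/eqP/eqP => fix_x; first by rewrite -{1}fix_x actK.
  by rewrite -{1}fix_x actKV.
rewrite -(inj_eq val_inj) /=; congr (_ == _).
apply: (@eq_from_nth _ 0%N); rewrite ?size_place ?size_rot ?rearr_size // => i lt_i.
rewrite -[i]/(val (Ordinal lt_i)) nth_place invgK sigmaXE /=.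
rewrite /rot nth_cat size_drop rearr_size nth_drop.
case: ltnP => [lt_ik|ge_ik].
  by rewrite modn_small; [rewrite addnC | move: lt_ik; rewrite ltn_subRL addnC].
rewrite nth_take; last by rewrite ltn_subLR // subnK // ltnW.
congr nth; rewrite -{1}(subnK ge_ik) -addnA subnK ?(ltnW lt_k) //.
rewrite modnDr modn_small //; apply: leq_ltn_trans lt_i; exact: leq_subr.
Qed.

Lemma cfdot_Ind_chi r :
  '['Ind[[set: 'S_n], Cn n] (cfRepr (chi prim r)),
    cfRepr (action_repr [set: 'S_n]%G (rearr_action s))]
  = n%:R^-1 * \sum_(k < n) omega ^+ (r * k) * (fix_count k)%:R.
Proof.
have sX_inj : {in [set: 'I_n] &, injective (fun k : 'I_n => (sigma n ^+ k)%g)}.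
  move=> k l _ _ /permP/(_ (Ordinal n_gt0))/(congr1 val).
  by rewrite /= !sigmaXE /= !add0n !modn_small // => /val_inj.
have CnE : Cn n = [set (sigma n ^+ (k : 'I_n))%g | k in [set: 'I_n]] :> {set _}.
  apply/setP => g; apply/idP/imsetP => [/cycleP[k ->]|[k _ ->]];
    last exact: mem_cycle.
  exists (Ordinal (ltn_pmod k n_gt0)); rewrite ?inE //=.
  by apply/permP => i; apply: val_inj; rewrite /= !sigmaXE modnDmr.
have sum_Cn (F : 'S_n -> algC) :
    \sum_(g in Cn n) F g = \sum_(k < n) F (sigma n ^+ k)%g.
  rewrite CnE big_imset //=; apply: eq_bigl => k; by rewrite inE.
have card_Cn : #|Cn n| = n by rewrite CnE card_in_imset // cardsT card_ord.
rewrite -Frobenius_reciprocity cfdotE sum_Cn card_Cn; congr (_ * _).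
apply: eq_bigr => k _; have Ck : (sigma n ^+ k)%g \in Cn n by exact: mem_cycle.
rewrite cfResE ?finset.subsetT // cfRepr_action ?inE // conjC_nat fix_action //.
congr (_ * _); rewrite cfunE Ck mulr1n /= chi_mx_sigmaX // mxtrace_scalar mulr1n.
by rewrite -exprM.
Qed.

End Fourier.

(** * The major index on rearrangements *)

Definition qint m : {poly algC} := \sum_(i < m) 'X^i.
Definition qfact m : {poly algC} := \prod_(i < m) qint i.+1.
Definition qmaj (s : seq nat) : {poly algC} :=
  \sum_(w <- permutations s) 'X^(maj w).
(** Cutting at a strict bound [N] of the letters makes the product finite; absent letters give the
    factor 1. *)
Definition qdenom N (s : seq nat) : {poly algC} :=
  \prod_(x < N) qfact (count_mem (x : nat) s).

Lemma qintD a b : qint (a + b) = qint a + 'X^a * qint b.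
Proof.
rewrite /qint big_split_ord /= mulr_sumr; congr (_ + _).
by apply: eq_bigr => i _; rewrite exprD.
Qed.

Lemma qint0 : qint 0 = 0. Proof. exact: big_ord0. Qed.

Lemma qint1 m : (qint m).[1] = m%:R.
Proof.
rewrite horner_sum; under eq_bigr do rewrite hornerXn expr1n.
by rewrite sumr_const card_ord.
Qed.

Lemma qfactS m : qfact m.+1 = qfact m * qint m.+1.
Proof. by rewrite /qfact big_ord_recr. Qed.

Lemma qfact1 m : (qfact m).[1] = (m`!)%:R.
Proof.
elim: m => [|m IH]; first by rewrite /qfact big_ord0 hornerC.
by rewrite qfactS hornerM IH qint1 -natrM factS mulnC.
Qed.

Lemma qint_neq0 m : (0 < m)%N -> qint m != 0.
Proof.
move=> m_gt0; apply/eqP => /(congr1 (fun p => p.[1])).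
by rewrite qint1 hornerC => /eqP; rewrite pnatr_eq0 -leqn0 leqNgt m_gt0.
Qed.

Lemma qfact_neq0 m : qfact m != 0.
Proof. by apply/prodf_neq0 => i _; apply: qint_neq0. Qed.

Lemma qdenom_neq0 N s : qdenom N s != 0.
Proof. by apply/prodf_neq0 => i _; apply: qfact_neq0. Qed.

Lemma maj_rcons u x : maj (rcons u x) = (maj u + (x < last 0 u) * size u)%N.
Proof.
rewrite /maj size_rcons; case: (lastP u) => [|v y].
  by rewrite !big_geq // muln0.
set u' := rcons v y; have sz : (0 < size u')%N by rewrite size_rcons.
rewrite big_mkcond big_nat_recr //= [in RHS]big_mkcond /=; congr (_ + _)%N.
  apply: eq_big_nat => i /andP[i_gt0 lt_i]; rewrite !nth_rcons lt_i.
  by rewrite (leq_ltn_trans (leq_pred i) lt_i).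
rewrite [nth _ (rcons u' x) (size u')]nth_rcons ltnn eqxx.
rewrite [nth _ (rcons u' x) _]nth_rcons prednK // leqnn.
rewrite {1}/u' size_rcons /= nth_rcons ltnn eqxx last_rcons.
by case: (x < y)%N; rewrite ?mul1n ?mul0n ?size_rcons.
Qed.

Lemma perm_rev_permutations (s : seq nat) :
  perm_eq (permutations s) [seq rev w | w <- permutations s].
Proof.
apply: uniq_perm; rewrite ?(map_inj_uniq (can_inj revK)) ?permutations_uniq // => w.
apply/idP/mapP => [w_s|[u u_s ->]];
  last by rewrite mem_permutations perm_rev -mem_permutations.
exists (rev w); rewrite ?revK //.
by rewrite mem_permutations perm_rev -mem_permutations.
Qed.

(** The enumeration of permutations splits off the first letter; reversing the words splits off the
    last. *)
Lemma sum_permutations_rcons (s : seq nat) (g : seq nat -> {poly algC}) :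
    (0 < size s)%N ->
  \sum_(w <- permutations s) g w =
  \sum_(x <- undup s) \sum_(u <- permutations (rem x s)) g (rcons u x).
Proof.
move=> s_gt0; rewrite (perm_big _ (perm_rev_permutations s)) big_map.
rewrite (perm_big _ (permutationsE s_gt0)) big_allpairs_dep /=.
apply: eq_bigr => x _; rewrite [RHS](perm_big _ (perm_rev_permutations _)) big_map.
by apply: eq_bigr => u _; rewrite rev_cons.
Qed.

(* q-counting the entries of s value by value, from the largest one down to b *)
Lemma sum_qint_count (s : seq nat) b :
  \sum_(x <- undup s | (b <= x)%N) 'X^(count (ltn x) s) * qint (count_mem x s)
    = qint (count (leq b) s).
Proof.
have [d bound] : exists d, forall x, x \in s -> (x < b + d)%N.
  exists (\max_(x <- s) x).+1 => x x_s; rewrite addnS ltnS.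
  apply: (leq_trans _ (leq_addl b _)).
  exact: (@leq_bigmax_seq _ s xpredT id x x_s isT).
elim: d b bound => [|d IH] b bound.
  rewrite big_seq_cond big1 => [|x /andP[]]; last first.
    by rewrite mem_undup => /bound; rewrite addn0 ltnNge => /negbTE ->.
  rewrite (@eq_in_count _ _ pred0) ?count_pred0 ?qint0 // => x /bound.
  by rewrite addn0 ltnNge => /negbTE.
have split_count : count (leq b) s = (count (ltn b) s + count_mem b s)%N.
  rewrite -count_predUI (@eq_count _ (predI _ _) pred0) ?count_pred0 ?addn0.
    by apply: eq_count => x; rewrite /= leq_eqVlt eq_sym orbC.
  by move=> x /=; case: (x =P b) => [->|_]; rewrite ?ltnn ?andbF.
rewrite split_count qintD (bigID (fun x => x == b)) /= addrC; congr (_ + _).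
  rewrite (eq_bigl (fun x => (b.+1 <= x)%N)) => [|x]; last first.
    by rewrite ltn_neqAle eq_sym andbC.
  by rewrite IH // => x /bound; rewrite addnS.
rewrite (eq_bigl (fun x => x == b)) => [|x]; last by case: eqP => [->|];
  rewrite ?leqnn ?andbF.
have [b_s|b_s] := boolP (b \in s).
  rewrite big_mkcond (bigD1_seq b) ?mem_undup ?undup_uniq //= eqxx big1 ?addr0 //.
  by move=> x /negbTE ->.
rewrite (count_memPn b_s) qint0 mulr0 big_seq_cond big1 // => x.
by rewrite mem_undup => /andP[x_s /eqP eq_x]; rewrite -eq_x x_s in b_s.
Qed.

Lemma sum_qint_size (s : seq nat) :
  \sum_(x <- undup s) 'X^(count (ltn x) s) * qint (count_mem x s) = qint (size s).
Proof. by have := sum_qint_count s 0;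
  rewrite (@eq_count _ (leq 0) predT) // count_predT. Qed.

Lemma qdenom_rem N (s : seq nat) x : (x < N)%N -> x \in s ->
  qdenom N s = qdenom N (rem x s) * qint (count_mem x s).
Proof.
move=> lt_x x_s; rewrite /qdenom (bigD1 (Ordinal lt_x)) //= [in RHS](bigD1
  (Ordinal lt_x)) //=.
have cnt y : count_mem y s = ((x == y) + count_mem y (rem x s))%N.
  by rewrite (seq.permP (perm_to_rem x_s)).
rewrite (cnt x) eqxx add1n qfactS mulrAC; congr (_ * _ * _).
apply: eq_bigr => y neq; rewrite cnt; case: eqP => // eq_xy.
by case/eqP: neq; apply: val_inj.
Qed.

Definition qmaj_last (s : seq nat) x : {poly algC} :=
  \sum_(u <- permutations (rem x s)) 'X^(maj (rcons u x)).

Lemma qmaj_nil : qmaj [::] = 1.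
Proof.
rewrite /qmaj (_ : permutations [::] = [:: [::]]) //.
by rewrite big_seq1 /maj big_geq // expr0.
Qed.

Lemma qmaj_rcons (s : seq nat) : (0 < size s)%N ->
  qmaj s = \sum_(x <- undup s) qmaj_last s x.
Proof. exact: sum_permutations_rcons. Qed.

Lemma qmaj_lastE (s : seq nat) x : (1 < size s)%N -> x \in s ->
  qmaj_last s x = \sum_(y <- undup (rem x s))
     'X^((x < y) * (size s).-1) * qmaj_last (rem x s) y.
Proof.
move=> s_gt1 x_s; rewrite /qmaj_last sum_permutations_rcons; last first.
  by rewrite size_rem // -ltnS (ltn_predK s_gt1).
rewrite big_seq [RHS]big_seq; apply: eq_bigr => y; rewrite mem_undup => y_s.
rewrite mulr_sumr big_seq [RHS]big_seq.
apply: eq_bigr => v; rewrite mem_permutations => v_s.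
rewrite maj_rcons last_rcons exprD mulrC; congr ('X^(_ * _) * _).
rewrite size_rcons (perm_size v_s) !size_rem //.
by case: (size s) s_gt1 => [|[]].
Qed.

(** Let t be s without its last letter x, and y the letter before x: position |t| is a descent
    exactly when x < y. With c the number of letters of t above x, splitting the sum over y at x
    reduces the refinement to q^|t| [c] + [|t|] - [c] = q^c [|t|], that is, to the two ways of
    splitting [|t| + c]. Summing over x then gives the product formula. *)
Theorem macmahon N (s : seq nat) : (forall x, x \in s -> (x < N)%N) ->
  qmaj s * qdenom N s = qfact (size s) /\
  (forall x, x \in s -> qmaj_last s x = 'X^(count (ltn x) s) * qmaj (rem x s)).
Proof.
move: {2}(size s) (leqnn (size s)) => m; elim: m s => [|m IH] s.
  rewrite leqn0 => /nilP -> _; split=> //.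
  rewrite qmaj_nil mul1r [RHS]big_ord0 /qdenom big1 // => x _.
  exact: big_ord0.
move=> sz_s s_lt; have [s0|s_gt0] := posnP (size s).
  by apply: IH => //; rewrite s0.
have rem_lt x y : y \in rem x s -> (y < N)%N by move/mem_rem/s_lt.
have sz_rem x : x \in s -> (size (rem x s) <= m)%N.
  by move=> x_s; rewrite size_rem // -ltnS (ltn_predK s_gt0).
have lastE x : x \in s -> qmaj_last s x = 'X^(count (ltn x) s) * qmaj (rem x s).
  move=> x_s; set t := rem x s; have t_m := sz_rem x x_s.
  have sz_t : size t = (size s).-1 by rewrite size_rem.
  have cnt : count (ltn x) s = count (ltn x) t.
    by rewrite (seq.permP (perm_to_rem x_s)) /= ltnn.
  have [s1|s_gt1] := leqP (size s) 1.
    have t0 : t = [::] by apply/nilP; rewrite /nilp sz_t;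
      case: (size s) s1 => [|[]].
    rewrite cnt t0 expr0 mul1r /qmaj_last -/t t0 qmaj_nil.
    by rewrite (_ : permutations [::] = [:: [::]]) // big_seq1 /maj big_geq.
  have [IH1 IH2] := IH t t_m (rem_lt x).
  have t_gt0 : (0 < size t)%N by rewrite sz_t -ltnS (ltn_predK s_gt1).
  (* The quotient of the product formulas for [t] and for [t] without y. *)
  have rem2 y : y \in t -> qmaj (rem y t) * qint (size t) = qmaj t * qint
    (count_mem y t).
    move=> y_t; have [|z /mem_rem z_t|IH3 _] := IH (rem y t).
    - by rewrite size_rem // (leq_trans (leq_pred _)).
    - exact: rem_lt z_t.
    apply: (mulIf (qdenom_neq0 N (rem y t))); rewrite mulrAC IH3 size_rem //.
    rewrite -{2}(prednK t_gt0) -qfactS prednK // -IH1 (qdenom_rem _ y_t)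
      ?(rem_lt x) //.
    by rewrite mulrA mulrAC.
  apply: (mulIf (qint_neq0 t_gt0)).
  rewrite qmaj_lastE // mulr_suml -sz_t -/t.
  transitivity ((\sum_(y <- undup t) 'X^((x < y) * size t) *
      ('X^(count (ltn y) t) * qint (count_mem y t))) * qmaj t).
    rewrite mulr_suml big_seq [RHS]big_seq; apply: eq_bigr => y;
      rewrite mem_undup => y_t.
    by rewrite IH2 // -!mulrA rem2 // [qmaj t * _]mulrC.
  rewrite -mulrA [qmaj t * _]mulrC mulrA cnt; congr (_ * _).
  pose g y : {poly algC} := 'X^(count (ltn y) t) * qint (count_mem y t).
  have sum_all : \sum_(y <- undup t) g y = qint (size t).
    exact: sum_qint_size.
  have sum_gt : \sum_(y <- undup t | (x < y)%N) g y = qint (count (ltn x) t).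
    by rewrite -(sum_qint_count t x.+1).
  have sum_le : \sum_(y <- undup t | ~~ (x < y)%N) g y
      = qint (size t) - qint (count (ltn x) t).
    rewrite -sum_all -sum_gt (bigID (fun y => (x < y)%N) predT) /=.
    by rewrite addrAC subrr add0r.
  rewrite (bigID (fun y => (x < y)%N)) /=.
  rewrite (eq_bigr (fun y => 'X^(size t) * g y)) => [|y ->]; last by rewrite mul1n.
  rewrite -mulr_sumr sum_gt (eq_bigr g) => [|y /negbTE ->]; last first.
    by rewrite mul0n expr0 mul1r.
  rewrite sum_le addrA [_ + qint (size t)]addrC -qintD addnC qintD.
  by rewrite addrAC subrr add0r.
split=> //; rewrite qmaj_rcons // mulr_suml -(prednK s_gt0) qfactS prednK //.
rewrite -(sum_qint_size s) mulr_sumr.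
rewrite big_seq [RHS]big_seq; apply: eq_bigr => x; rewrite mem_undup => x_s.
have [IH1 _] := IH (rem x s) (sz_rem x x_s) (rem_lt x).
rewrite lastE // (qdenom_rem (s_lt _ x_s) x_s) -(size_rem x_s) -IH1.
by rewrite -!mulrA mulrCA; congr (_ * _); exact: mulrCA.
Qed.

(** * The major index at roots of unity *)

Section RootOfUnity.
Variables (d : nat) (zeta : algC).
Hypothesis prim : d.-primitive_root zeta.
Let d_gt0 : (0 < d)%N. Proof. exact: prim_order_gt0 prim. Qed.

Lemma qint_root k : (zeta - 1) * (qint k).[zeta] = zeta ^+ k - 1.
Proof.
rewrite subrX1; congr (_ * _); rewrite horner_sum.
by apply: eq_bigr => i _; rewrite hornerXn.
Qed.

Lemma qint_root_eq0 : (1 < d)%N -> (qint d).[zeta] = 0.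
Proof.
move=> d_gt1; have z1 : zeta - 1 != 0.
  rewrite subr_eq0; apply/eqP => z1; have := prim_order_dvd prim 1.
  by rewrite expr1 z1 eqxx dvdn1 => /eqP d1; rewrite d1 in d_gt1.
by apply: (mulfI z1); rewrite qint_root (prim_expr_order prim) subrr mulr0.
Qed.

Lemma qint_root_neq0 k : ~~ (d %| k)%N -> (qint k).[zeta] != 0.
Proof.
move=> ndk; apply/eqP => q0; case/negP: ndk.
by rewrite (prim_order_dvd prim) -subr_eq0 -qint_root q0 mulr0.
Qed.

Lemma qint_root_mod a k : ~~ (d %| k)%N ->
  (qint (d * a + k)).[zeta] = (qint k).[zeta].
Proof.
move=> ndk; have z1 : zeta - 1 != 0.
  rewrite subr_eq0; apply: contra ndk => /eqP z1.
  by rewrite (prim_order_dvd prim) z1 expr1n.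
apply: (mulfI z1); rewrite !qint_root exprD exprM (prim_expr_order prim).
by rewrite expr1n mul1r.
Qed.

(* The factor of [k]_q left over after removing [d]_q whenever d divides k. *)
Definition qint_part k : {poly algC} :=
  if (d %| k)%N then \sum_(j < k %/ d) 'X^(d * j) else qint k.

Lemma qint_partE k : qint k = qint d ^+ (d %| k)%N * qint_part k.
Proof.
rewrite /qint_part; case: ifP => [/dvdnP[a ->]|_]; last by rewrite expr0 mul1r.
rewrite mulnK // expr1; elim: a => [|a IH];
  first by rewrite big_ord0 mulr0 mul0n qint0.
rewrite mulSn addnC qintD IH big_ord_recr /= mulrDr; congr (_ + _).
by rewrite mulnC mulrC.
Qed.

Lemma qint_part_root k :
  (qint_part k).[zeta] = if (d %| k)%N then (k %/ d)%:R else (qint k).[zeta].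
Proof.
rewrite /qint_part; case: ifP => // _; rewrite horner_sum.
under eq_bigr do rewrite hornerXn exprM (prim_expr_order prim) expr1n.
by rewrite sumr_const card_ord.
Qed.

Definition qfact_part m : {poly algC} := \prod_(i < m) qint_part i.+1.

Lemma qfact_partE m : qfact m = qint d ^+ (m %/ d) * qfact_part m.
Proof.
elim: m => [|m IH]; first by rewrite /qfact /qfact_part !big_ord0 div0n mulr1.
rewrite qfactS IH (qint_partE m.+1) divnS // exprD /qfact_part [in
  RHS]big_ord_recr /=.
by rewrite mulrACA [_ ^+ (m %/ d) * _]mulrC.
Qed.

Lemma qfact_part_neq0 m : (qfact_part m).[zeta] != 0.
Proof.
rewrite horner_prod; apply/prodf_neq0 => i _; rewrite qint_part_root.
case: ifP => [dk|/negbT]; last exact: qint_root_neq0.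
by rewrite pnatr_eq0 -lt0n divn_gt0 // dvdn_leq.
Qed.

(** In each block of d consecutive factors, those at indices not divisible by d depend at zeta only
    on the residue, while the last factor of block number a + 1 has the value a + 1. *)
Lemma qfact_part_mul a :
  (qfact_part (d * a)).[zeta] = (a`!)%:R * (qfact_part d).[zeta] ^+ a.
Proof.
elim: a => [|a IH]; first by rewrite muln0 /qfact_part big_ord0 hornerC mulr1.
rewrite mulnS addnC /qfact_part big_split_ord /= hornerM -/(qfact_part _) IH.
have prod_last (g : nat -> algC) : \prod_(i < d) g i = \prod_(i < d.-1) g i * g
  d.-1.
  by rewrite -[in LHS](prednK d_gt0) big_ord_recr.
suff -> : (\prod_(i < d) qint_part (d * a + i).+1).[zeta]
    = a.+1%:R * (qfact_part d).[zeta].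
  by rewrite exprSr factS natrM mulrACA; congr (_ * _); exact: mulrC.
rewrite /qfact_part !horner_prod.
rewrite (prod_last (fun i => (qint_part (d * a + i).+1).[zeta])).
rewrite (prod_last (fun i => (qint_part i.+1).[zeta])) mulrCA; congr (_ * _).
  apply: eq_bigr => i _; rewrite -addnS !qint_part_root dvdn_addr ?dvdn_mulr //.
  have ndi : ~~ (d %| i.+1)%N.
    apply/negP => /(dvdn_leq (ltn0Sn _)); rewrite leqNgt => /negP; apply.
    by rewrite -ltn_predRL.
  by rewrite (negbTE ndi) qint_root_mod.
rewrite -addnS prednK // !qint_part_root dvdnn dvdn_add ?dvdn_mulr // divnn d_gt0.
by rewrite mulr1 -mulnSr mulKn.
Qed.

Lemma qmaj1 s : (qmaj s).[1] = (size (permutations s))%:R.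
Proof.
rewrite /qmaj horner_sum -sum1_size natr_sum.
by apply: eq_bigr => w _; rewrite hornerXn expr1n.
Qed.

Lemma qdenom1 N s : (qdenom N s).[1] = (\prod_(x < N) (count_mem (x : nat) s)`!)%:R.
Proof.
by rewrite /qdenom horner_prod natr_prod; apply: eq_bigr => x _; rewrite qfact1.
Qed.

(** * The q-multinomial coefficient at a primitive d-th root of unity *)

Section Evaluate.
Variable n : nat.
Variable s : n.-tuple nat.
Hypothesis n_gt0 : (0 < n)%N.
Hypothesis d_n : (d %| n)%N.
Let N := (\max_(x <- s) x).+1.
Local Notation cnt x := (count_mem (x : nat) s).

Lemma lt_max x : x \in val s -> (x < N)%N.
Proof. by move=> x_s; rewrite ltnS;
  exact: (@leq_bigmax_seq _ (val s) xpredT id x). Qed.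

Lemma sum_count (t : seq nat) : (forall x, x \in t -> (x < N)%N) ->
  (\sum_(x < N) count_mem (x : nat) t = size t)%N.
Proof.
move=> t_lt; rewrite -count_predT.
elim: t t_lt => [|y t IH] t_lt; first by rewrite big1.
rewrite /= -IH => [|x x_t]; last by apply: t_lt; rewrite inE x_t orbT.
rewrite big_split /=; congr (_ + _)%N.
have lt_y : (y < N)%N by apply: t_lt; rewrite mem_head.
rewrite (bigD1 (Ordinal lt_y)) //= eqxx big1 // => x neq.
by case: eqP => // eq_y; case/eqP: neq; apply: val_inj.
Qed.

Let sum_cnt : (\sum_(x < N) cnt x = n)%N.
Proof. by rewrite (sum_count lt_max) size_tuple. Qed.

(** The product formula with the powers of [d] cancelled; the exponent left over is positive exactly
    when d fails to divide some multiplicity. *)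
Lemma qmaj_part :
  qmaj s * \prod_(x < N) qfact_part (cnt x)
    = qint d ^+ (n %/ d - \sum_(x < N) (cnt x %/ d)) * qfact_part n.
Proof.
have [mac _] := macmahon lt_max; rewrite size_tuple in mac.
have le_E : (\sum_(x < N) (cnt x %/ d) <= n %/ d)%N.
  rewrite leq_divRL // big_distrl /= -[leqRHS]sum_cnt; apply: leq_sum => x _.
  exact: leq_divM.
have Q0 : qint d ^+ (\sum_(x < N) (cnt x %/ d)) != 0.
  by rewrite expf_neq0 // qint_neq0.
apply: (mulfI Q0); rewrite [RHS]mulrA -exprD subnKC // -qfact_partE -mac mulrCA.
congr (_ * _); rewrite /qdenom expr_sum -big_split /=.
by apply: eq_bigr => x _; rewrite -qfact_partE.
Qed.

(** The multiset s divided by d, written as a sorted word; if d divides all multiplicities, it is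
    the content of the d-th roots of rearrangements of s. *)
Let t := flatten [seq nseq (cnt x %/ d) x | x <- iota 0 N].

Let cnt_t x : count_mem x t = (cnt x %/ d)%N.
Proof.
rewrite /t count_flatten -map_comp sumnE big_map.
have [x_s|x_s] := boolP (x \in val s); last first.
  rewrite (count_memPn x_s) div0n big1 // => y _; rewrite /= count_nseq /=.
  by case: eqP => [->|_]; rewrite ?mul0n // (count_memPn x_s) div0n.
rewrite (bigD1_seq x) ?iota_uniq ?mem_iota ?lt_max //= count_nseq /= eqxx mul1n.
by rewrite big1 ?addn0 // => y /negbTE neq; rewrite count_nseq /= neq mul0n.
Qed.

Let t_lt x : x \in t -> (x < N)%N.
Proof.
by case/flattenP => u /mapP[y]; rewrite mem_iota => /andP[_ lt_y] -> /nseqP[-> _].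
Qed.

(** The product formula at q = 1 is the multinomial coefficient. *)
Lemma size_permutations_part :
  (size (permutations t) * \prod_(x < N) (cnt x %/ d)`! = (size t)`!)%N.
Proof.
have [/(congr1 (fun p => p.[1]))] := macmahon t_lt.
rewrite qfact1 hornerM qmaj1 qdenom1 -natrM => /eqP; rewrite eqC_nat => /eqP <- _.
by congr (_ * _)%N; apply: eq_bigr => x _; rewrite cnt_t.
Qed.

Lemma perm_wpow u : perm_eq (wpow u d) s <->
  perm_eq u t /\ (forall x, d %| cnt x)%N.
Proof.
have cnt_wpow x : count_mem x (wpow u d) = (d * count_mem x u)%N.
  by rewrite /wpow count_flatten map_nseq sumn_nseq mulnC.
split=> [pw|[pu d_cnt]].
  have eq_cnt x : cnt x = (d * count_mem x u)%N.
    by rewrite -cnt_wpow (seq.permP pw).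
  split=> [|x]; last by rewrite eq_cnt dvdn_mulr.
  by apply/allP => x _ /=; rewrite cnt_t eq_cnt mulKn.
apply/allP => x _ /=; rewrite cnt_wpow (seq.permP pu) cnt_t mulnC divnK //.
Qed.

Lemma rot_wpowP w : size w = n ->
  (rot (n %/ d) w == w) = (w == wpow (take (n %/ d) w) d).
Proof.
move=> sz_w; have le_e : (n %/ d <= size w)%N by rewrite sz_w leq_div.
have sz_t : size (take (n %/ d) w) = (n %/ d)%N by rewrite size_takel.
apply/eqP/eqP => [rot_w|->]; last by rewrite -{1}sz_t rot_wpow.
have sz_d : size (drop (n %/ d) w) = (d.-1 * (n %/ d))%N.
  by rewrite size_drop sz_w -{1}(divnK d_n) -subn1 mulnBl mul1n mulnC.
move: (n %/ d)%N sz_t sz_d rot_w => e sz_t sz_d rot_w.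
rewrite -(prednK d_gt0) wpowS -{1}(cat_take_drop e w); congr (_ ++ _).
by apply: comm_wpow; rewrite ?sz_t // cat_take_drop -[LHS]rot_w.
Qed.

Lemma qmaj_root : (qmaj s).[zeta] = (fix_count s (n %/ d))%:R.
Proof.
have := congr1 (fun p => p.[zeta]) qmaj_part.
rewrite !hornerM horner_prod.
have prod_neq0 : \prod_(x < N) (qfact_part (cnt x)).[zeta] != 0.
  by apply/prodf_neq0 => x _; exact: qfact_part_neq0.
have e_gt0 : (0 < n %/ d)%N by rewrite divn_gt0 // dvdn_leq.
have sz_perm w : w \in permutations s -> size w = n.
  by rewrite mem_permutations => /perm_size ->; rewrite size_tuple.
(* If d fails to divide some multiplicity, a factor [d] survives and vanishes at zeta, while no
   rearrangement of s is a d-th power. *)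
have [/forallP d_cnt|] := boolP [forall x : 'I_N, d %| cnt x]%N; last first.
  rewrite negb_forall => /existsP[x nd_x].
  have lt_E : (\sum_(x < N) (cnt x %/ d) < n %/ d)%N.
    rewrite ltn_divRL // big_distrl /= -[ltnRHS]sum_cnt.
    rewrite (bigD1 x) //= [ltnRHS](bigD1 x) //= -addSn leq_add //.
      by rewrite ltn_neqAle leq_divM andbT -dvdn_eq.
    by apply: leq_sum => y _; exact: leq_divM.
  have d_gt1 : (1 < d)%N.
    by case: (d) d_gt0 nd_x => [|[|]] //; rewrite dvd1n.
  rewrite horner_exp qint_root_eq0 // expr0n subn_eq0 leqNgt lt_E /= mul0r => /eqP.
  rewrite mulf_eq0 (negbTE prod_neq0) orbF => /eqP ->.
  rewrite /fix_count; apply/esym/eqP; rewrite pnatr_eq0 -leqn0 leqNgt -has_count.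
  apply/hasP => -[w w_s]; rewrite rot_wpowP ?sz_perm // => /eqP def_w.
  rewrite mem_permutations def_w in w_s; have [_ /(_ x)] := (perm_wpow _).1 w_s.
  by rewrite (negbTE nd_x).
have dvd_cnt x : (d %| cnt x)%N.
  have [x_s|/count_memPn -> //] := boolP (x \in val s).
  exact: (d_cnt (Ordinal (lt_max x_s))).
have cntE (x : 'I_N) : cnt x = (cnt x %/ d * d)%N by rewrite divnK.
have sum_E : (\sum_(x < N) (cnt x %/ d) = n %/ d)%N.
  apply/eqP; rewrite -(eqn_pmul2r d_gt0) divnK // big_distrl /=; apply/eqP.
  by rewrite -[RHS]sum_cnt; apply: eq_bigr => x _; rewrite -cntE.
have part_n : qfact_part n = qfact_part (d * (n %/ d)) by rewrite mulnC divnK.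
have sz_t : size t = (n %/ d)%N.
  by rewrite -sum_E -(sum_count t_lt); apply: eq_bigr => x _; rewrite cnt_t.
have C0 : (qfact_part d).[zeta] != 0 by exact: qfact_part_neq0.
rewrite sum_E subnn expr0 hornerC mul1r part_n qfact_part_mul.
rewrite (eq_bigr (fun x : 'I_N => ((cnt x %/ d)`!)%:R * (qfact_part d).[zeta]
  ^+ (cnt x %/ d)));
  last by move=> x _; rewrite [in LHS]cntE mulnC qfact_part_mul.
(* The power of the value of [qfact_part d] cancels; what remains is the multinomial coefficient of
   the divided multiplicities, which counts the d-th roots. *)
rewrite big_split /= prodrXr sum_E mulrA => /(mulIf (expf_neq0 _ C0)).
rewrite -sz_t -size_permutations_part natrM natr_prod => /mulIf -> //; last first.
  by apply/prodf_neq0 => x _; rewrite pnatr_eq0 -lt0n fact_gt0.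
congr (_ %:R); rewrite /fix_count -size_filter sz_t -(size_map (wpow^~ d)).
have wpow_e u : u \in permutations t -> size u = (n %/ d)%N.
  by rewrite mem_permutations => /perm_size ->.
apply: perm_size; apply: uniq_perm; rewrite ?filter_uniq ?permutations_uniq //.
  rewrite map_inj_in_uniq ?permutations_uniq // => u v u_t v_t /= eq_uv.
  have := congr1 (take (1 * (n %/ d))) eq_uv.
  by rewrite -{1}(wpow_e u u_t) -(wpow_e v v_t) !take_wpow // !wpow1.
move=> w; rewrite mem_filter; apply/mapP/andP => [[u u_t ->]|[rot_w w_s]].
  have pw : perm_eq (wpow u d) s by apply/perm_wpow; rewrite -mem_permutations.
  by rewrite mem_permutations pw -{1}(wpow_e u u_t) rot_wpow eqxx.
rewrite rot_wpowP ?sz_perm // in rot_w; rewrite (eqP rot_w) in w_s.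
exists (take (n %/ d) w); last exact/eqP.
rewrite mem_permutations in w_s; rewrite mem_permutations.
by have [] := (perm_wpow _).1 w_s.
Qed.

End Evaluate.
End RootOfUnity.

(** The root omega^k has order n / gcd(k, n), and rotation by k fixes the same words of length n as
    rotation by gcd(k, n), because periods divide n. *)
Lemma sum_maj_root n (s : n.-tuple nat) (omega : algC) k :
    n.-primitive_root omega -> (k < n)%N ->
  \sum_(w <- permutations s) omega ^+ (k * maj w) = (fix_count s k)%:R.
Proof.
move=> prim lt_k; have n_gt0 := prim_order_gt0 prim.
have gcd_gt0 : (0 < gcdn k n)%N by rewrite gcdn_gt0 n_gt0 orbT.
have prim_k := exp_prim_root prim k.
transitivity (qmaj s).[omega ^+ k].
  by rewrite /qmaj horner_sum; apply: eq_bigr => w _; rewrite hornerXn exprM.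
rewrite (qmaj_root prim_k) ?dvdn_div ?dvdn_gcdr //; congr (_ %:R).
have -> : (n %/ (n %/ gcdn k n) = gcdn k n)%N by rewrite divnA ?dvdn_gcdr // mulKn.
apply: eq_in_count => w; rewrite mem_permutations => /perm_size.
rewrite size_tuple => sz_w; have w_gt0 : (0 < size w)%N by rewrite sz_w.
have p_n : (period w %| n)%N by rewrite -sz_w; exact: period_dvd.
have le_gcd : (gcdn k n <= size w)%N by rewrite sz_w dvdn_leq ?dvdn_gcdr.
have le_k : (k <= size w)%N by rewrite sz_w ltnW.
by rewrite !rot_dvd // dvdn_gcd p_n andbT.
Qed.

(** * The three generating functions *)

Lemma Maj_count n (s : n.-tuple nat) r : all (leq 1) s ->
  content_gf wcont (Maj n r) (seq_mset s)
    = (count (fun w => majn n w == r) (permutations s))%:R.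
Proof.
move=> s_gt0; rewrite -size_filter; apply: content_gf_size.
  by rewrite filter_uniq ?permutations_uniq.
move=> w; rewrite mem_filter.
split=> [[[w_n maj_w] w_s]|/andP[/eqP maj_w /(perms_words s_gt0)[]]//].
by rewrite maj_w eqxx; apply/(perms_words s_gt0).
Qed.

Lemma majn_eq n w r : (0 < r <= n)%N -> (majn n w == r) = (maj w == r %[mod n])%N.
Proof.
case/andP=> r_gt0 le_r; have n_gt0 := leq_trans r_gt0 le_r; rewrite /majn.
have lt_m := ltn_pmod (maj w) n_gt0.
move: le_r; rewrite leq_eqVlt => /orP[/eqP ->|lt_r].
  rewrite modnn; case: (_ =P 0%N) => [_|neq]; first by rewrite eqxx.
  exact: ltn_eqF.
rewrite (modn_small lt_r); case: (_ =P 0%N) => [->|//].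
by rewrite (gtn_eqF lt_r) eq_sym (gtn_eqF r_gt0).
Qed.

(** Orthogonality extracts the class of r with the factor omega^(- r k), the conjugate of omega^(r
    k) since omega has modulus 1. *)
Lemma sum_maj_count n (s : n.-tuple nat) (omega : algC) r :
    n.-primitive_root omega -> (0 < r <= n)%N ->
  \sum_(k < n) (omega ^+ (r * k))^* * (fix_count s k)%:R =
    n%:R * (count (fun w => majn n w == r) (permutations s))%:R.
Proof.
move=> prim r_bd; have n_gt0 := prim_order_gt0 prim.
have omega_norm : `|omega| = 1.
  apply/eqP; rewrite -(pexpr_eq1 n_gt0) ?normr_ge0 // -normrX.
  by rewrite (prim_expr_order prim) normr1.
have omega_conj : omega^* = omega^-1.
  by rewrite invC_norm omega_norm expr1n invr1 mul1r.
have omega_neq0 : omega != 0 by rewrite -normr_eq0 omega_norm oner_eq0.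
transitivity (\sum_(k < n) \sum_(w <- permutations s)
    (omega ^+ maj w / omega ^+ r) ^+ k).
  apply: eq_bigr => k _; rewrite -(sum_maj_root s prim (ltn_ord k)) mulr_sumr.
  apply: eq_bigr => w _; rewrite rmorphXn /= omega_conj expr_div_n -!exprM exprVn.
  by rewrite mulrC [(k * _)%N]mulnC.
rewrite exchange_big /= -sum1_count natr_sum mulr_sumr big_mkcond
  [RHS]big_mkcond /=.
apply: eq_bigr => w _; rewrite sum_root_unity; last first.
  rewrite expr_div_n -!exprM ![(_ * n)%N]mulnC !exprM (prim_expr_order prim).
  by rewrite !expr1n divr1.
rewrite majn_eq // -(eq_prim_root_expr prim).
have <- : (omega ^+ maj w / omega ^+ r == 1) = (omega ^+ maj w == omega ^+ r).
  by rewrite -(inj_eq (mulIf (expf_neq0 r omega_neq0))) mulfVK ?expf_neq0 ?mul1r.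
by rewrite mulr1.
Qed.

Theorem theorem1p7 (n r : nat) (omega : algC)
    (prim : n.-primitive_root omega)
    (hn : (1 <= n)%N) (hr : (1 <= r <= n)%N) :
  [/\ Ch ('Ind[[set: 'S_n], Cn n] (cfRepr (chi prim r)))
        = content_gf ncont (NFD n r),
      content_gf ncont (NFD n r) = content_gf wcont (Flex n r)
    & content_gf wcont (Flex n r) = content_gf wcont (Maj n r)].
Proof.
have eq_coef alpha : [/\ Ch ('Ind[[set: 'S_n], Cn n] (cfRepr (chi prim r))) alpha
        = content_gf ncont (NFD n r) alpha,
      content_gf ncont (NFD n r) alpha = content_gf wcont (Flex n r) alpha
    & content_gf wcont (Flex n r) alpha = content_gf wcont (Maj n r) alpha].
  (* A monomial that is not the content of a word of length n has coefficient 0 in every series;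
     otherwise any word of that content serves as [s]. *)
  have [[w [[w_n w_gt0] <-{alpha}]]|none] :=
      pselect (exists w, words n w /\ wcont w = alpha); last first.
    rewrite Ch_eq0 => [|w w_n eq_w]; last by apply: none; exists w.
    rewrite !content_gf_eq0 // => [w [w_n _] eq_w|w [w_n _] eq_w|N].
    - by apply: none; exists w.
    - by apply: none; exists w.
    case=> -[w [w_n w_gt0] <-{N}] _ eq_w; apply: none.
    have sz_w : (0 < size w)%N by rewrite w_n.
    have u_w := necklace_repr sz_w; set u := xget _ _ in u_w.
    have pu : perm_eq u w.
      by case/(rotationsP sz_w): u_w => i ->; rewrite perm_rot.
    exists u; split; last exact: eq_w.
    by split; [rewrite (perm_size pu) | rewrite (perm_all _ pu)].
  pose s : n.-tuple nat := tcast w_n (in_tuple w).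
  have -> : wcont w = seq_mset s by rewrite val_tcast.
  have s_gt0 : all (leq 1) s by rewrite val_tcast.
  rewrite Ch_rearr // cfdot_Ind_chi (sum_fix_count_flex s prim hr) (NFD_count
    prim s_gt0 hr).
  rewrite Flex_count // Maj_count // mulKf ?pnatr_eq0 -?lt0n //; split=> //.
  have n_neq0 : n%:R != 0 :> algC by rewrite pnatr_eq0 -lt0n.
  apply: (mulfI n_neq0); rewrite -(sum_maj_count s prim hr).
  (* The left side is a natural number, hence its own conjugate; conjugating its sum termwise gives
     the sum for the major index. *)
  rewrite -natrM -[LHS]conjC_nat natrM -(sum_fix_count_flex s prim hr)
    rmorph_sum /=.
  by apply: eq_bigr => k _; rewrite rmorphM /= conjC_nat.
by split; apply: boolp.funext => alpha; have [] := eq_coef alpha.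
Qed.
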